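(* Let $k$ be an algebraically closed field of characteristic zero, $G$ a finite group, $R_G=B^{(2)}_k(G,G)$ the degree-two cocycle-decorated double Burnside ring, and $\Omega_G$ the distinguished basis of $B^{(2)}_k(G,1)$. For $a,b\in\Omega_G$ put $E_{a,b}:=a\circ_1b^\vee\in R_G$, and for $b,c\in\Omega_G$ let $c_{b,c}$ be the positive integer with $b^\vee\circ_Gc=c_{b,c}$ in $B^{(2)}_k(1,1)=\mathbb Z$. Then the subgroup $J_G:=\mathbb Z\text{-span}\{E_{a,b}\mid a,b\in\Omega_G\}$ is a two-sided based ideal of $R_G$, and $$E_{a,b}E_{c,d}=c_{b,c}E_{a,d}\qquad(a,b,c,d\in\Omega_G).$$ It is the unique minimal nonzero based ideal of $R_G$.
   Context: A based ideal is a two-sided ideal that is the $\mathbb Z$-span of a subset of the distinguished basis. For finite groups $G,H$, $B^{(2)}_k(G,H)$ is the free abelian group with distinguished basis $[L,\mu]$ indexed by $(G\times H)$-conjugacy classes of pairs $(L,[\mu])$, $L\le G\times H$, $[\mu]\in H^2(L,k^\times)$ (trivial action). Thus the basis $\Omega_G$ of $B^{(2)}_k(G,1)$ consists of the $G$-conjugacy classes $[H,\alpha]$ of pairs $(H,[\alpha])$, $H\le G$, $[\alpha]\in H^2(H,k^\times)$, and $B^{(2)}_k(1,1)=\mathbb Z$. For $S\le P\times Q$, $p_1(S),p_2(S)$ are the images in $P,Q$; $k_1(S)=\{a:(a,1)\in S\}$, $k_2(S)=\{b:(1,b)\in S\}$. Clifford composition $\circ_H:B^{(2)}_k(G,H)\times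 B^{(2)}_k(H,K)\to B^{(2)}_k(G,K)$ is bilinear and given on basis elements (normalized cocycles) by $$[L,\mu]\circ_H[M,\nu]=\sum_{g\in p_2(L)\backslash H/p_1(M)}\ \sum_{[\pi]\in N_g\backslash\mathrm{Irr}(A_g)}[N_{g,\pi},\lambda_{g,\pi}],$$ where $M^g=(g,1)M(g,1)^{-1}$, $\nu^g$ is $\nu$ transported along this conjugation, $F_g=\{((a,b),(b,c)):(a,b)\in L,(b,c)\in M^g\}$, $q_g((a,b),(b,c))=(a,c)$, $N_g=q_g(F_g)\le G\times K$, $K_g=k_2(L)\cap k_1(M^g)\cong\ker q_g$, $\eta_g=\mathrm{pr}_L^*\mu\,\mathrm{pr}_M^*\nu^g\in Z^2(F_g,k^\times)$, $\alpha_g=\eta_g|_{K_g}$. The twisted group algebra $\widetilde A_g=k_{\eta_g}[F_g]$ ($u_fu_{f'}=\eta_g(f,f')u_{ff'}$) is strongly $N_g$-graded via $q_g$ with degree-one part $A_g=k_{\alpha_g}[K_g]$; $N_g$ acts on the set $\mathrm{Irr}(A_g)$ of isomorphism classes of simple modules by $n\cdot[\pi]=[(\widetilde A_g)_n\otimes_{A_g}\pi]$; $N_{g,\pi}$ is the stabilizer of $[\pi]$; for chosen isomorphisms $c_n:(\widetilde A_g)_n\otimes_{A_g}\pi\to\pi$ ($n\in N_{g,\pi}$) and multiplication maps $\vartheta_{n,m}$, the cocycle $\lambda_{g,\pi}$ is defined by $c_n(\mathrm{id}\otimes c_m)=\lambda_{g,\pi}(n,m)^{-1}c_{nm}(\vartheta_{n,m}\otimes\mathrm{id})$.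 Composition is associative with identities $[\Delta(G),1]$ and corresponds to the relative tensor product of the associated $\mathrm{Vec}_G$--$\mathrm{Vec}_H$ bimodule categories. $R_G=B^{(2)}_k(G,G)$ with product $\circ_G$. The basis-preserving duality $(-)^\vee:B^{(2)}_k(G,H)\to B^{(2)}_k(H,G)$ (bimodule duality) satisfies $(x\circ_Hy)^\vee=y^\vee\circ_Hx^\vee$; in coordinates $[L,\mu]^\vee=[L^t,(\mu^t)^{-1}]$, where $L^t=\{(h,g):(g,h)\in L\}$ and $\mu^t$ is $\mu$ transported along the swap. Each $E_{a,b}$ is a distinguished basis element of $R_G$, and distinct pairs $(a,b)$ give distinct elements. *)

(* Defs.v *)
From HB Require Import structures.
From mathcomp Require Import boolp classical_sets fsbigop.
From mathcomp Require Import all_boot all_order all_fingroup all_algebra.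
From mathcomp Require Import freeg ring.

Set Implicit Arguments.
Unset Strict Implicit.
Unset Printing Implicit Defensive.

Import GroupScope GRing.Theory.
Local Open Scope group_scope.
Local Open Scope ring_scope.
Local Open Scope quotient_scope.

Fact unit_mulgA : associative (fun _ _ : unit => tt). Proof. by []. Qed.
Fact unit_mul1g : left_id tt (fun _ _ : unit => tt). Proof. by case. Qed.
Fact unit_mulVg : left_inverse tt (fun _ => tt) (fun _ _ : unit => tt).
Proof. by []. Qed.
HB.instance Definition _ :=
  Finite_isGroup.Build unit unit_mulgA unit_mul1g unit_mulVg.

(* Normalized 2-cocycles on L with values in the units of k (trivial action);
   the values of mu outside L * L are irrelevant. *)
Record is_cocycle (k : fieldType) (gT : finGroupType) (L : {set gT})
    (mu : gT -> gT -> k) : Prop := IsCocycle {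
  cocycle_neq0 : {in L &, forall x y, mu x y != 0};
  cocycleP : {in L & &, forall x y z,
    mu x y * mu (x * y)%g z = mu y z * mu x (y * z)%g};
  cocycle1l : {in L, forall x, mu 1%g x = 1};
  cocycle1r : {in L, forall x, mu x 1%g = 1}
}.

Fact cocycle_comp (k : fieldType) (gT hT : finGroupType) (L : {set gT})
    (M : {group hT}) (j : hT -> gT) (mu : gT -> gT -> k) :
    {in M &, {morph j : x y / (x * y)%g}} -> {in M, forall x, j x \in L} ->
  is_cocycle L mu -> is_cocycle M (fun x y => mu (j x) (j y)).
Proof.
move=> jM jL [n0 cP l1 r1].
have j1 : j 1%g = 1%g by apply: (mulgI (j 1%g)); rewrite -jM ?mulg1.
split=> [x y xM yM|x y z xM yM zM|x xM|x xM].
- by rewrite n0 ?jL.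
- by rewrite !jM ?groupM // cP ?jL.
- by rewrite j1 l1 ?jL.
- by rewrite j1 r1 ?jL.
Qed.

Fact cocycle_mul (k : fieldType) (gT : finGroupType) (L : {set gT})
    (mu nu : gT -> gT -> k) : is_cocycle L mu -> is_cocycle L nu ->
  is_cocycle L (fun x y => mu x y * nu x y).
Proof.
move=> [n0 cP l1 r1] [n0' cP' l1' r1'].
split=> [x y xL yL|x y z xL yL zL|x xL|x xL].
- by rewrite mulf_neq0 ?n0 ?n0'.
- by rewrite mulrACA cP // cP' // mulrACA.
- by rewrite l1 // l1' // mulr1.
- by rewrite r1 // r1' // mulr1.
Qed.

Fact cocycle_inv (k : fieldType) (gT : finGroupType) (L : {set gT})
    (mu : gT -> gT -> k) : is_cocycle L mu ->
  is_cocycle L (fun x y => (mu x y)^-1).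
Proof.
move=> [n0 cP l1 r1]; split=> [x y xL yL|x y z xL yL zL|x xL|x xL].
- by rewrite invr_neq0 ?n0.
- by rewrite -!invfM cP.
- by rewrite l1 // invr1.
- by rewrite r1 // invr1.
Qed.

Section DecoratedSubgroups.

Variables (k : fieldType) (gT : finGroupType).

(* Equality of classes in H^2 of L with coefficients in the units of k. *)
Definition cohomologous (L : {set gT}) (mu nu : gT -> gT -> k) :=
  exists2 b : gT -> k, {in L, forall x, b x != 0} &
    {in L &, forall x y, nu x y = mu x y * (b x * b y / b (x * y)%g)}.

Record deco := Deco {
  dgrp :> {group gT};
  dcoc : gT -> gT -> k;
  dcocP : is_cocycle dgrp dcoc
}.

HB.instance Definition _ := gen_eqMixin deco.
HB.instance Definition _ := gen_choiceMixin deco.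

Fact deco1_proof (L : {group gT}) : is_cocycle L (fun _ _ => 1 : k).
Proof. by split => *; rewrite ?oner_neq0. Qed.
Definition deco1 L := Deco (deco1_proof L).

Fact dconj_proof (p : deco) (g : gT) :
  is_cocycle (p :^ g^-1)%g (fun x y => dcoc p (x ^ g)%g (y ^ g)%g).
Proof.
have E x : (x \in p :^ g^-1)%g = (x ^ g \in p)%g by rewrite mem_conjgV.
case: (dcocP p) => n0 cP l1 r1; split => [x y|x y z|x|x].
- by rewrite !E; apply: n0.
- by rewrite !E !conjMg; apply: cP.
- by rewrite E conj1g; apply: l1.
- by rewrite E conj1g; apply: r1.
Qed.

(* (g L g^-1, mu^g); mathcomp's x ^ g is g^-1 * x * g. *)
Definition dconj (p : deco) (g : gT) := Deco (dconj_proof p g).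

Definition deco_rel (p q : deco) : bool :=
  `[< exists g, dgrp (dconj p g) = dgrp q /\
        cohomologous q (dcoc (dconj p g)) (dcoc q) >].

Fact deco_rel_refl : reflexive deco_rel.
Proof.
move=> p; apply/asboolP; exists 1%g; split.
  by apply/val_inj; rewrite /= invg1 conjsg1.
exists (fun _ => 1) => [x _|x y _ _]; first exact: oner_neq0.
by rewrite /= !conjg1 !mul1r invr1 mulr1.
Qed.

Fact deco_rel_sym_imp p q : deco_rel p q -> deco_rel q p.
Proof.
move=> /asboolP[g [/(congr1 val)/= eL [b b0 bE]]]; apply/asboolP; exists g^-1%g.
have eL' : (q :^ g = p)%g by rewrite -eL conjsgKV.
split; first by apply/val_inj; rewrite /= invgK.
have mq x : x \in p -> (x ^ g^-1)%g \in q by rewrite -eL memJ_conjg.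
exists (fun x => (b (x ^ g^-1)%g)^-1) => [x xp|x y xp yp].
  by rewrite invr_neq0 // b0 // mq.
rewrite /= bE ?mq // !conjgKV -conjMg -mulrA.
set X := b _; set Y := b _; set Z := b _.
have X0 : X != 0 by rewrite b0 ?mq.
have Y0 : Y != 0 by rewrite b0 ?mq.
have Z0 : Z != 0 by rewrite b0 ?mq ?groupM.
by field; rewrite X0 Y0 Z0 oner_neq0.
Qed.

Fact deco_rel_sym : symmetric deco_rel.
Proof. by move=> p q; apply/idP/idP; apply: deco_rel_sym_imp. Qed.

Fact deco_rel_trans : transitive deco_rel.
Proof.
move=> q p r /asboolP[g [/(congr1 val)/= eL [b b0 bE]]].
move=> /asboolP[h [/(congr1 val)/= eM [c c0 cE]]].
apply/asboolP; exists (h * g)%g; split.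
  by apply/val_inj; rewrite /= invMg conjsgM eL eM.
have mr x : x \in r -> (x ^ h)%g \in q by rewrite -eM mem_conjgV.
exists (fun x => b (x ^ h)%g * c x) => [x xr|x y xr yr].
  by rewrite mulf_neq0 ?b0 ?c0 ?mr.
rewrite cE //= bE ?mr //= !conjgM !conjMg -!mulrA; congr (_ * _).
have bxy0 : b (x ^ h * y ^ h)%g != 0 by rewrite -conjMg b0 ?mr ?groupM.
by field; rewrite bxy0 c0 ?groupM.
Qed.

Canonical deco_equiv :=
  EquivRel deco_rel deco_rel_refl deco_rel_sym deco_rel_trans.
Canonical deco_equiv_direct := defaultEncModRel deco_rel.

Definition dclass := {eq_quot deco_rel}.
HB.instance Definition _ := Quotient.on dclass.
HB.instance Definition _ := Choice.on dclass.
HB.instance Definition _ : EqQuotient _ deco_rel dclass :=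
  EqQuotient.on dclass.

Definition dclass_of (p : deco) : dclass := \pi_dclass p.
Definition dclass_rep (x : dclass) : deco := generic_quotient.repr x.

End DecoratedSubgroups.

(* k_eta[F] for p = (F, eta): formal linear combinations of the basis u_f,
   f in F, with u_f * u_f' = eta f f' *: u_(f f'). *)
Section TwistedGroupAlgebra.

Variables (k : fieldType) (gT : finGroupType) (p : deco k gT).
Local Notation subF := (subg_of p).

Definition tga := {ffun subF -> k^o}.
HB.instance Definition _ := GRing.Lmodule.on tga.

Definition tga_mul (x y : tga) : tga :=
  [ffun f => \sum_(a : subF)
     dcoc p (val a) (val (a^-1 * f)%g) * x a * y (a^-1 * f)%g].

Definition tga_basis (f : subF) : tga := [ffun h => (h == f)%:R].

Definition tga_one : tga := tga_basis 1%g.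

Fact tga_mulA : associative tga_mul.
Proof.
case: (dcocP p) => _ cP _ _ x y z; apply/ffunP => f; rewrite !ffunE.
under eq_bigr => a _ do rewrite ffunE big_distrr /=.
under [RHS]eq_bigr => c _ do rewrite ffunE big_distrr big_distrl /=.
rewrite [RHS]exchange_big /=; apply: eq_bigr => a _.
rewrite [RHS](reindex_inj (mulgI a)) /=; apply: eq_bigr => b _.
set d := (b^-1 * (a^-1 * f))%g.
have -> : (a^-1 * (a * b) = b)%g by exact: mulKg.
have -> : ((a * b)^-1 * f = d)%g by rewrite /d invMg mulgA.
have E := cP _ _ _ (subgP a) (subgP b) (subgP d).
move: E; rewrite /= !mulKVg mulKg invMg -mulgA => E.
set s := dcoc p _ _; set t := dcoc p (sgval b) _.
transitivity (t * s * x a * y b * z d); first by ring.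
by rewrite -E /s /t; ring.
Qed.

Fact tga_mul1x : left_id tga_one tga_mul.
Proof.
case: (dcocP p) => _ _ c1 _ x; apply/ffunP => f; rewrite !ffunE.
rewrite (bigD1 1%g) //= big1 ?addr0 => [|a /negPf a1].
  by rewrite ffunE eqxx /= !invg1 !mul1g c1 ?subgP // !mul1r; congr (x _);
    apply/val_inj; rewrite /= invg1 mul1g.
by rewrite ffunE a1 mulr0 mul0r.
Qed.

Fact tga_mulx1 : right_id tga_one tga_mul.
Proof.
case: (dcocP p) => _ _ _ c1 x; apply/ffunP => f; rewrite !ffunE.
rewrite (bigD1 f) //= big1 ?addr0 => [|a af].
  by rewrite ffunE (mulVg f) eqxx /= mulVg c1 ?subgP // mul1r mulr1.
by rewrite ffunE -eq_mulVg1 (negPf af) mulr0.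
Qed.

Fact tga_mulDl : left_distributive tga_mul +%R.
Proof.
move=> x y z; apply/ffunP => f; rewrite !ffunE -big_split /=.
by apply: eq_bigr => a _; rewrite !ffunE mulrDr mulrDl.
Qed.

Fact tga_mulDr : right_distributive tga_mul +%R.
Proof.
move=> x y z; apply/ffunP => f; rewrite !ffunE -big_split /=.
by apply: eq_bigr => a _; rewrite !ffunE mulrDr.
Qed.

Fact tga_1_neq0 : tga_one != 0.
Proof.
by apply/eqP => /ffunP/(_ 1%g)/eqP; rewrite !ffunE eqxx oner_eq0.
Qed.

HB.instance Definition _ := GRing.Zmodule_isNzRing.Build tga
  tga_mulA tga_mul1x tga_mulx1 tga_mulDl tga_mulDr tga_1_neq0.

Fact tga_scalerAl (c : k) (x y : tga) : c *: (x * y) = c *: x * y.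
Proof.
apply/ffunP => f; rewrite !ffunE scaler_sumr; apply: eq_bigr => a _.
by rewrite ffunE /GRing.scale /=; ring.
Qed.

HB.instance Definition _ :=
  GRing.Lmodule_isLalgebra.Build k tga tga_scalerAl.

Fact tga_scalerAr (c : k) (x y : tga) : c *: (x * y) = x * (c *: y).
Proof.
apply/ffunP => f; rewrite !ffunE scaler_sumr; apply: eq_bigr => a _.
by rewrite ffunE /GRing.scale /=; ring.
Qed.

HB.instance Definition _ :=
  GRing.Lalgebra_isAlgebra.Build k tga tga_scalerAr.

Lemma tga_basisM (f h : subF) :
  tga_basis f * tga_basis h =
    dcoc p (val f) (val h) *: tga_basis (f * h)%g :> tga.
Proof.
apply/ffunP => d; rewrite [LHS]ffunE [RHS]ffunE /GRing.scale /=.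
rewrite (bigD1 f) //= big1 ?addr0 => [|a /negPf af].
  rewrite !ffunE eqxx mulr1 eq_sym -(inj_eq (mulgI f)) mulKVg eq_sym.
  by have [->|] := eqVneq d (f * h)%g; rewrite ?mulr0 //= mulKg.
by rewrite !ffunE af mulr0 mul0r.
Qed.

End TwistedGroupAlgebra.

(* Finite-dimensional left A-modules on column vectors; simple modules over a
   finite-dimensional algebra are all of this kind up to isomorphism. *)
Section Modules.

Variables (k : fieldType) (A : algType k).

Record fdmod := FDMod {
  mdim : nat;
  fdact :> {lrmorphism A -> 'M[k]_mdim}
}.

Definition is_simple (V : fdmod) :=
  (0 < mdim V)%N /\
  forall U : {vspace 'cV[k]_(mdim V)},
    (forall a v, v \in U -> V a *m v \in U) -> U = 0%VS \/ U = fullv.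

Record simple_mod := SimpleMod { smod :> fdmod; smodP : is_simple smod }.

HB.instance Definition _ := gen_eqMixin simple_mod.
HB.instance Definition _ := gen_choiceMixin simple_mod.

Definition iso_mod (V W : simple_mod) : bool :=
  `[< exists (P : 'M_(mdim W, mdim V)) (Q : 'M_(mdim V, mdim W)),
        [/\ P *m Q = 1%:M, Q *m P = 1%:M &
            forall a, P *m V a = W a *m P] >].

Fact iso_mod_refl : reflexive iso_mod.
Proof.
move=> V; apply/asboolP; exists 1%:M, 1%:M.
by split=> [||a]; rewrite ?mul1mx ?mulmx1.
Qed.

Fact iso_mod_sym_imp V W : iso_mod V W -> iso_mod W V.
Proof.
move=> /asboolP[P [Q [PQ QP PE]]]; apply/asboolP; exists Q, P; split=> // a.
by rewrite -[LHS]mulmx1 -PQ mulmxA -[Q *m _ *m P]mulmxA -PE mulmxA QP mul1mx.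
Qed.

Fact iso_mod_sym : symmetric iso_mod.
Proof. by move=> V W; apply/idP/idP; apply: iso_mod_sym_imp. Qed.

Fact iso_mod_trans : transitive iso_mod.
Proof.
move=> W V U /asboolP[P [Q [PQ QP PE]]] /asboolP[R [S [RS SR RE]]].
apply/asboolP; exists (R *m P), (Q *m S); split=> [||a].
- by rewrite mulmxA -[R *m P *m Q]mulmxA PQ mulmx1.
- by rewrite mulmxA -[Q *m S *m R]mulmxA SR mulmx1.
- by rewrite -mulmxA PE mulmxA RE mulmxA.
Qed.

Canonical iso_mod_equiv :=
  EquivRel iso_mod iso_mod_refl iso_mod_sym iso_mod_trans.
Canonical iso_mod_equiv_direct := defaultEncModRel iso_mod.

Definition Irr := {eq_quot iso_mod}.
HB.instance Definition _ := Quotient.on Irr.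
HB.instance Definition _ := Choice.on Irr.
HB.instance Definition _ : EqQuotient _ iso_mod Irr := EqQuotient.on Irr.

Definition irr_rep (X : Irr) : simple_mod := generic_quotient.repr X.

End Modules.

(* Clifford theory of k_eta[F], p = (F, eta), graded by q : F -> N; the
   degree-one part is presented as k_alpha[K], r = (K, alpha), through an
   isomorphism j of K onto ker q with alpha = eta \o j. *)
Section Clifford.

Variables (k : fieldType) (gT nT hT : finGroupType).
Variables (p : deco k gT) (q : gT -> nT) (r : deco k hT) (j : hT -> gT).
Local Notation At := (tga p).
Local Notation A := (tga r).

Definition homogeneous (n : nT) (x : At) : Prop :=
  forall f, x f != 0 -> q (val f) = n.

Definition deg1_incl (a : A) : At :=
  \sum_(b : subg_of r) a b *: tga_basis (subg p (j (val b))).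

(* x, v |-> c x *m v is k-bilinear and A-balanced on At_n x V. *)
Definition balanced (n : nT) (V : fdmod A) d
    (c : {linear At -> 'M[k]_(d, mdim V)}) :=
  forall x a, homogeneous n x -> c (x * deg1_incl a) = c x *m V a.

(* x (x) v |-> c x *m v is an isomorphism of A-modules from the tensor product
   of At_n and V over A onto W: W has the universal property of the tensor
   product, tested on finite-dimensional targets (the tensor product itself is
   finite-dimensional). The values of c outside At_n are irrelevant. *)
Definition tensor_iso (n : nT) (V W : fdmod A)
    (c : {linear At -> 'M[k]_(mdim W, mdim V)}) :=
  [/\ balanced n c,
      forall x a, homogeneous n x -> c (deg1_incl a * x) = W a *m c x &
      forall d (b : {linear At -> 'M[k]_(d, mdim V)}), balanced n b ->
        exists! h : 'M[k]_(d, mdim W),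
          forall x, homogeneous n x -> b x = h *m c x].

(* n . [V] = [At_n (x)_A V]; such a Y exists whenever n is in q @: p. *)
Definition irr_act (n : nT) (X : Irr A) : Irr A :=
  xget X [set Y | exists c,
    tensor_iso n (V := irr_rep X) (W := irr_rep Y) c]%classic.

Definition irr_orbits : set (set (Irr A)) :=
  [set O | exists X,
     O = [set Y | exists2 n, n \in q @: p & Y = irr_act n X]]%classic.

Definition irr_stab (X : Irr A) : {set nT} :=
  [set n in q @: p | irr_act n X == X].

Definition obstruction (X : Irr A) (lambda : nT -> nT -> k) :=
  exists c : nT -> {linear At -> 'M[k]_(mdim (irr_rep X), mdim (irr_rep X))},
    (forall n, n \in irr_stab X ->
       tensor_iso n (V := irr_rep X) (W := irr_rep X) (c n)) /\
    (forall n m x y, n \in irr_stab X -> m \in irr_stab X ->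
       homogeneous n x -> homogeneous m y ->
       c n x *m c m y = (lambda n m)^-1 *: c (n * m)%g (x * y)).

(* (N_pi, lambda_pi) for a representative [pi] of the orbit O. *)
Definition orbit_deco (O : set (Irr A)) : deco k nT :=
  xget (deco1 k 1%G)
    [set t : deco k nT | exists2 X, O X &
       irr_stab X = dgrp t /\ obstruction X (dcoc t)]%classic.

End Clifford.

Arguments irr_orbits {k gT nT hT} p q r j.

Section ProductSubgroups.

Variables gT hT : finGroupType.

Definition p1 (L : {group gT * hT}) : {group gT} := [group of fst @* L].
Definition p2 (L : {group gT * hT}) : {group hT} := [group of snd @* L].
Definition k1 (L : {group gT * hT}) : {group gT} :=
  [group of @pairg1 gT hT @*^-1 L].
Definition k2 (L : {group gT * hT}) : {group hT} :=
  [group of @pair1g gT hT @*^-1 L].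

End ProductSubgroups.

Definition bicl k (gT hT : finGroupType) := dclass k (gT * hT)%type.

Definition B2 k (gT hT : finGroupType) := {freeg (bicl k gT hT) / int}.

Definition B2base k gT hT (x : bicl k gT hT) : B2 k gT hT := Freeg [:: (1, x)].

Section Composition.

Variables (k : fieldType) (gT hT kT : finGroupType).

(* F_g, eta_g, q_g, K_g and alpha_g of the composition formula, with M in the
   role of the conjugate M^g; ker_emb is the isomorphism of K_g with ker q_g. *)
Section Fibre.

Variables (L : deco k (gT * hT)%type) (M : deco k (hT * kT)%type).

Definition fib : {set (gT * hT) * (hT * kT)} :=
  [set f | [&& f.1 \in L, f.2 \in M & f.1.2 == f.2.1]].

Fact fib_group_set : group_set fib.
Proof.
apply/group_setP; split=> [|x y]; rewrite !inE ?group1 ?eqxx //=.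
case/and3P=> x1 x2 /eqP ex /and3P[y1 y2 /eqP ey].
by rewrite !groupM //= ex ey eqxx.
Qed.
Canonical fib_group := Group fib_group_set.

Definition fib_coc (f f' : (gT * hT) * (hT * kT)) : k :=
  dcoc L f.1 f'.1 * dcoc M f.2 f'.2.

Fact fib_coc_proof : is_cocycle fib_group fib_coc.
Proof.
apply: cocycle_mul.
  by apply: cocycle_comp (dcocP L) => // x; rewrite inE => /and3P[].
by apply: cocycle_comp (dcocP M) => // x; rewrite inE => /and3P[].
Qed.

Definition fib_deco := Deco fib_coc_proof.

Definition fib_proj (f : (gT * hT) * (hT * kT)) : gT * kT := (f.1.1, f.2.2).

Definition ker_emb (b : hT) : (gT * hT) * (hT * kT) := ((1, b), (b, 1))%g.

Definition ker_grp : {group hT} := (k2 L :&: k1 M)%G.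

Fact ker_coc_proof :
  is_cocycle ker_grp (fun b b' => fib_coc (ker_emb b) (ker_emb b')).
Proof.
apply: cocycle_comp fib_coc_proof => [b b' _ _|b].
  by congr (_, _); congr (_, _); rewrite mulg1.
by rewrite !inE /= => /andP[-> ->] /=.
Qed.

Definition ker_deco := Deco ker_coc_proof.

(* Sum over N_g\Irr(A_g), which is finite. *)
Definition ccomp_term : B2 k gT kT :=
  \sum_(O \in irr_orbits fib_deco fib_proj ker_deco ker_emb)
     B2base (dclass_of (orbit_deco fib_deco fib_proj ker_emb O)).

End Fibre.

Definition ccomp_basis (x : bicl k gT hT) (y : bicl k hT kT) : B2 k gT kT :=
  let L := dclass_rep x in let M := dclass_rep y in
  \sum_(D in [set p2 L :* g * p1 M | g : hT]%g)
     ccomp_term L (dconj M (repr D, 1%g)).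

Definition ccomp (x : B2 k gT hT) (y : B2 k hT kT) : B2 k gT kT :=
  fglift (fun a => fglift (ccomp_basis a) y) x.

End Composition.

Section Duality.

Variables (k : fieldType) (gT hT : finGroupType).

Definition swap (x : hT * gT) : gT * hT := (x.2, x.1).

Fact swap_morphM : {in setT &, {morph swap : x y / (x * y)%g}}.
Proof. by []. Qed.
Canonical swap_morphism := Morphism swap_morphM.

Variable L : deco k (gT * hT)%type.

Fact dual_proof :
  is_cocycle (swap @*^-1 L) (fun x y => (dcoc L (swap x) (swap y))^-1).
Proof.
apply: cocycle_inv; apply: (cocycle_comp (M := [group of swap @*^-1 L]) _ _
  (dcocP L)) => // x.
by move=> xL; move: (xL); rewrite inE => /andP[_]; rewrite inE.
Qed.

(* [L, mu]^v = [L^t, (mu^t)^-1] *)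
Definition dual_deco : deco k (hT * gT)%type := Deco dual_proof.

End Duality.

Definition B2dual k gT hT (x : B2 k gT hT) : B2 k hT gT :=
  fglift (fun a => B2base (dclass_of (dual_deco (dclass_rep a)))) x.

Definition zspan (V : zmodType) (S : set V) : set V :=
  [set x | exists2 s : seq (int * V), {in s, forall a, S a.2} &
     x = \sum_(a <- s) a.2 *~ a.1]%classic.

Section Ideals.

Variables (k : fieldType) (gT : finGroupType).
Local Notation RG := (B2 k gT gT).
Implicit Types I : set RG.

Definition ideal I :=
  [/\ I 0, forall x y, I x -> I y -> I (x - y),
      forall r x, I x -> I (ccomp r x) & forall r x, I x -> I (ccomp x r)].

Definition based_ideal I :=
  ideal I /\ exists S : set (bicl k gT gT),
    I = zspan [set B2base b | b in S]%classic.

Definition nonzero_based_ideal I :=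
  based_ideal I /\ exists2 x, I x & x != 0.

Definition minimal_based_ideal I :=
  nonzero_based_ideal I /\
  forall I', nonzero_based_ideal I' -> (I' `<=` I)%classic -> I' = I.

Definition Omega := bicl k gT unit.

Definition E_ (a b : Omega) : RG := ccomp (B2base a) (B2dual (B2base b)).

Definition J_ : set RG := zspan [set x | exists a b, x = E_ a b]%classic.

(* B2 k unit unit has this single basis element, so coeff id11 identifies it
   with int. *)
Definition id11 : bicl k unit unit :=
  dclass_of (deco1 k [1 (unit * unit)%type]%G).

Definition cpair (b c : Omega) : int :=
  coeff id11 (ccomp (B2dual (B2base b)) (B2base c)).

End Ideals.

Arguments J_ : clear implicits.

(* Main.v *)
From HB Require Import structures.
Require Import Defs.
From mathcomp Require Import boolp classical_sets cardinality fsbigop.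
From mathcomp Require Import all_boot all_order all_fingroup all_algebra.
From mathcomp Require Import finmap freeg ring.

(* An element [L, mu] of B(G, H) with L = P x Q and mu a product cocycle (up to
   coboundary) is called split here; by Kunneth this only asks that mu vanish
   on commutators between P x 1 and 1 x Q.  The E_(a,b) are exactly the split
   basis elements of R_G.

   If one of the two factors of a composition is split, the kernel-centralizing
   lifts ((x,1),(1,1)) or ((1,1),(1,z)) act on every simple module by scalars
   (Schur), so all terms [N_pi, lambda_pi] are split: J_G is a based ideal.  If
   both factors are split, these lifts form a section of F -> N centralizing K;
   then N acts trivially on Irr(A) and every lambda_pi is the product of the
   outer restrictions of the two cocycles.  Hence the product is a multiple of
   one basis element, and the multiplicity, the number of simple modules summed
   over double cosets, only depends on the classes of the inner restrictions.
   This gives both c_(b,c) and the multiplication rule, with no appeal to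
   associativity of the composition.

   Minimality: for a basis element z of a based ideal I, E_(c,c) z is a nonempty
   sum of E_(a,b)'s, so E_(c,c) (E_(c,c) z) E_(d,d) is a positive multiple of
   E_(c,d), and E_(c,d) lies in I because I is based. *)

Set Implicit Arguments.
Unset Strict Implicit.
Unset Printing Implicit Defensive.

Import Order.TTheory GRing.Theory Num.Theory.
Local Open Scope ring_scope.

(** * Simple modules *)

Lemma mx_eq_act (R : nzRingType) m n (M N : 'M[R]_(m, n)) :
  (forall v : 'cV_n, M *m v = N *m v) -> M = N.
Proof.
move=> MN; apply/trmx_inj/row_matrixP => i.
by rewrite -!tr_col !colE MN.
Qed.

Section SimpleModules.

Variables (k : fieldType) (A : algType k).
Implicit Types V W : simple_mod A.

Lemma act1 (V : fdmod A) : V 1 = 1%:M.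
Proof. by rewrite rmorph1. Qed.

Lemma actM (V : fdmod A) a b : V (a * b) = V a *m V b.
Proof. by rewrite rmorphM. Qed.

(** Schur: the kernel and the image of [P] are submodules, so [P != 0] makes [P] bijective, and
    [pinvmx P] is then a two-sided inverse. *)
Lemma simple_intertwiner_iso V W (P : 'M_(mdim W, mdim V)) :
  (forall a, P *m V a = W a *m P) -> P != 0 -> iso_mod V W.
Proof.
move=> PE P0; case: (smodP V) => _ sV; case: (smodP W) => _ sW.
pose f : 'Hom('cV[k]_(mdim V), 'cV[k]_(mdim W)) := linfun (mulmx P).
have fE v : f v = P *m v by rewrite lfunE.
have kerf : lker f = 0%VS.
  case: (sV (lker f)) => [a v|//|kf].
    by rewrite !memv_ker !fE mulmxA PE -mulmxA => /eqP->; rewrite mulmx0.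
  case/eqP: P0; apply: mx_eq_act => v; rewrite mul0mx; apply/eqP.
  by have := memvf v; rewrite -kf memv_ker fE.
have imf : limg f = fullv.
  case: (sW (limg f)) => [a w /memv_imgP[v _ ->]|im0|//].
    by rewrite fE mulmxA -PE -mulmxA -fE memv_img ?memvf.
  case/eqP: P0; apply: mx_eq_act => v; rewrite mul0mx; apply/eqP.
  by have := memv_img f (memvf v); rewrite im0 memv0 fE.
have rfull : row_full P.
  rewrite /row_full -mxrank_tr; apply: inj_row_free => u uP.
  apply: trmx_inj; rewrite trmx0; apply/eqP; rewrite -memv0 -kerf memv_ker fE.
  by rewrite -[P]trmxK -trmx_mul uP trmx0.
have rfree : row_free P.
  apply: inj_row_free => u uP; apply/rowP => i; rewrite mxE.
  have : (delta_mx i ord0 : 'cV[k]_(mdim W)) \in limg f by rewrite imf memvf.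
  case/memv_imgP => v _; rewrite fE => /(congr1 (mulmx u)).
  rewrite mulmxA uP mul0mx -colE => /matrixP/(_ ord0 ord0).
  by rewrite !mxE.
apply/asboolP; exists P, (pinvmx P); split=> //.
  by rewrite mulmxVp.
by rewrite mulVpmx.
Qed.

End SimpleModules.

(** An eigenvalue [s] exists because [k] is algebraically closed and [mdim V] is positive; the
    kernel of [M - s] is then a nonzero submodule, hence everything. The transpose appears because
    [eigenvalue] is about row vectors while modules act on columns. *)
Lemma schur_scalar (k : closedFieldType) (A : algType k) (V : simple_mod A)
    (M : 'M_(mdim V)) : (forall a, M *m V a = V a *m M) ->
  exists s : k, M = s%:M.
Proof.
move=> ME; case: (smodP V) => dV sV.
have [s rs] : exists s, root (char_poly M^T) s.
  by apply/closed_rootP; rewrite size_char_poly; case: (mdim V) dV.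
move: rs; rewrite -eigenvalue_root_char => /eigenvalueP[v vM v0].
exists s; apply/eqP; rewrite -subr_eq0; apply/eqP.
pose f : 'End('cV[k]_(mdim V)) := linfun (mulmx (M - s%:M)).
have fE u : f u = (M - s%:M) *m u by rewrite lfunE.
have ker : lker f = fullv.
  case: (sV (lker f)) => [a u|k0|//].
    rewrite !memv_ker !fE => /eqP h.
    by rewrite mulmxA mulmxBl ME -scalar_mxC -mulmxBr -mulmxA h mulmx0.
  case/eqP: v0; apply: trmx_inj; rewrite trmx0; apply/eqP.
  rewrite -memv0 -k0 memv_ker fE mulmxBl -[M]trmxK -trmx_mul vM mul_scalar_mx.
  by rewrite linearZ subrr.
apply: mx_eq_act => u; rewrite mul0mx; apply/eqP.
by have := memvf u; rewrite -ker memv_ker fE.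
Qed.

(** * Finiteness of the set of simple modules of a twisted group algebra *)

HB.instance Definition _ (k : fieldType) (gT : finGroupType) (p : deco k gT) :=
  Vector.on (tga p).

Section FiniteIrr.

Variables (k : fieldType) (gT : finGroupType) (p : deco k gT).
Local Notation A := (tga p).
Implicit Types (V W : simple_mod A) (s : seq (simple_mod A)).

Let ev V (v : 'cV_(mdim V)) : 'Hom(A, 'cV[k]_(mdim V)) :=
  linfun (mulmxr v \o fdact V).

Let evE V v a : @ev V v a = V a *m v.
Proof. by rewrite lfunE. Qed.

Let pt V : 'cV[k]_(mdim V) := const_mx 1.

Let pt_neq0 V : pt V != 0.
Proof.
case: (smodP V) => dV _; apply/eqP => /matrixP/(_ (Ordinal dV) ord0)/eqP.
by rewrite !mxE oner_eq0.
Qed.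

(* Adding to s a simple module that is not isomorphic to a member of s strictly
   shrinks this left ideal, so there are at most dim A simple modules. *)
Fixpoint annihilator s : {vspace A} :=
  if s is V :: s' then (lker (ev (pt V)) :&: annihilator s')%VS else fullv.

Let annM s a b : b \in annihilator s -> a * b \in annihilator s.
Proof.
elim: s => [|V s IH] /=; first by rewrite !memvf.
rewrite !memv_cap !memv_ker !evE => /andP[/eqP h /IH ->].
by rewrite actM -mulmxA h mulmx0 eqxx.
Qed.

(** Induction on [s], with [J] the annihilator of the tail. By simplicity [J] sends the base vector
    of [V] onto 0 or all of [V]. In the first case, or if [J] kills [w], the tail suffices;
    otherwise [a * pt V |-> a * w], for [a] in [J], is a nonzero intertwiner from [V] to [W]. *)
Lemma annihilator_sub_iso s W (w : 'cV_(mdim W)) : w != 0 ->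
  (forall a, a \in annihilator s -> W a *m w = 0) ->
  exists2 V, V \in s & iso_mod V W.
Proof.
move=> w0; elim: s => [/(_ 1 (memvf _))|V s IH] /=.
  by rewrite act1 mul1mx => /eqP; rewrite (negPf w0).
move=> annw; set J := annihilator s in IH annw *.
pose f : 'Hom(A, _) := ev (pt V); pose g : 'Hom(A, _) := ev w.
have step : (forall a, a \in J -> W a *m w = 0) ->
    exists2 V0, V0 \in V :: s & iso_mod V0 W.
  by move=> /IH[V0 V0s isoV0]; exists V0; rewrite // inE V0s orbT.
case: (smodP V) => _ /(_ (f @: J)%VS)[a v /memv_imgP[b bJ ->]|fJ|fJ].
- by rewrite evE mulmxA -actM -evE memv_img // annM.
- apply: step => a aJ; apply: annw; rewrite memv_cap aJ andbT memv_ker.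
  by rewrite -memv0 -fJ memv_img.
have [/step//|/existsNP[a0 /not_implyP[a0J /eqP a0w]]] :=
  pselect (forall a, a \in J -> W a *m w = 0).
exists V; first by rewrite mem_head.
(* [f'] and [g'] are [f] and [g] restricted to [J] through a projection. The map [h] uses a linear
   section of [f']; the choice is harmless since elements of [J] killed by [f] lie in the
   annihilator of [V :: s], hence kill [w]. *)
pose f' : 'Hom(A, _) := (f \o projv J)%VF.
pose g' : 'Hom(A, _) := (g \o projv J)%VF.
pose h := (g' \o f'^-1)%VF.
have hE a : a \in J -> h (V a *m pt V) = W a *m w.
  move=> aJ; rewrite -evE -/f.
  have fa : f a = f' a by rewrite comp_lfunE projv_id.
  have faim : f' a \in limg f' by rewrite memv_img ?memvf.
  have gK c : f' c = 0 -> g' c = 0.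
    rewrite !comp_lfunE => fc; rewrite evE; apply: annw.
    by rewrite memv_cap memv_proj andbT memv_ker fc.
  rewrite fa comp_lfunE.
  have -> : W a *m w = g' a by rewrite comp_lfunE projv_id // evE.
  apply/eqP; rewrite -subr_eq0; apply/eqP.
  transitivity (g' ((f'^-1)%VF (f' a) - a)); first by rewrite linearB.
  by apply: gK; rewrite linearB /= limg_lfunVK // subrr.
pose P := (lin1_mx (fun r : 'rV_(mdim V) => (h r^T)^T))^T.
have PE u : P *m u = h u.
  rewrite -[u]trmxK -trmx_mul.
  have lin : linear (fun r : 'rV_(mdim V) => (h r^T)^T).
    by move=> c x y; rewrite linearP /= linearP /= linearP.
  pose L := HB.pack_for {linear 'rV[k]_(mdim V) -> 'rV[k]_(mdim W)}
    (fun r : 'rV_(mdim V) => (h r^T)^T) (GRing.isLinear.Build _ _ _ _ _ lin).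
  by have := mul_rV_lin1 L u^T => /= ->; rewrite !trmxK.
apply: (simple_intertwiner_iso (P := P)) => [a|].
  apply: mx_eq_act => v; rewrite -!mulmxA !PE.
  have : v \in (f @: J)%VS by rewrite fJ memvf.
  case/memv_imgP => b bJ ->; rewrite evE mulmxA -actM !hE ?annM //.
  by rewrite actM mulmxA.
apply: contraNneq a0w => P0.
by rewrite -hE // -PE P0 mul0mx.
Qed.

Lemma dim_annihilator s :
    (forall i j : nat, (i < j < size s)%N -> forall V0,
       ~~ iso_mod (nth V0 s i) (nth V0 s j)) ->
  (\dim (annihilator s) + size s <= \dim {:A})%N.
Proof.
elim: s => [_|V s IH ns] /=; first by rewrite addn0.
have : (\dim (annihilator s) + size s <= \dim {:A})%N.
  by apply: IH => i j lij V0; have := ns i.+1 j.+1 lij V0.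
apply: leq_trans; rewrite addnS -addSn leq_add2r.
(* If the dimension did not drop, [annihilator s] would kill the base vector of [V], and [V] would
   be isomorphic to a member of [s]. *)
rewrite ltn_neqAle dimvS ?capvSr // andbT; apply/negP => /eqP dE.
have E : (lker (ev (pt V)) :&: annihilator s = annihilator s)%VS.
  by apply/eqP; rewrite eqEdim capvSr dE leqnn.
have [a|W Ws iWV] := @annihilator_sub_iso s V _ (pt_neq0 V).
  by rewrite -E memv_cap memv_ker evE => /andP[/eqP].
have := ns 0%N (index W s).+1; rewrite /= ltnS index_mem => /(_ Ws V).
by rewrite nth_index // iso_mod_sym iWV.
Qed.

Lemma finite_Irr : finite_set [set: Irr A].
Proof.
apply: contrapT => /(@infinite_set_fset _ _ (\dim {:A}).+1)[B _ cB].
pose s := [seq irr_rep X | X <- enum_fset B].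
have sz : size s = #|` B| by rewrite size_map.
suff : (\dim (annihilator s) + size s <= \dim {:A})%N.
  by rewrite sz leqNgt (leq_trans cB) ?leq_addl.
apply: dim_annihilator => i j; rewrite size_map => /andP[ij jB] V0.
have iB := ltn_trans ij jB.
rewrite !(nth_map (\pi_(Irr A) V0)%qT) //.
rewrite -(eqmodE (iso_mod_equiv A)) !reprK nth_uniq ?fset_uniq //.
by rewrite (ltn_eqF ij).
Qed.

End FiniteIrr.

(** * Existence of simple modules *)

Section BuildModule.

Variables (k : fieldType) (A : algType k) (d : nat) (f : A -> 'M[k]_d).
Hypotheses (f_lin : linear f) (f1 : f 1 = 1%:M).
Hypothesis fM : forall a b, f (a * b) = f a *m f b.

Definition build_fdmod : fdmod A :=
  FDMod (HB.pack_for {lrmorphism A -> 'M[k]_d} f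
    (GRing.isLinear.Build k A 'M[k]_d *:%R f f_lin)
    (GRing.isMonoidMorphism.Build A 'M[k]_d f (f1, fM))).

End BuildModule.

Section ExistsSimple.

Variables (k : fieldType) (A : algType k).

(** The columns of [B] span a submodule, stable by the second hypothesis, and [C] reads coordinates
    on it. Only the dimension is recorded, which is all that the descent in [exists_simple]
    consumes. *)
Lemma fdmod_restrict (V : fdmod A) e (B : 'M_(mdim V, e)) (C : 'M_(e, mdim V)) :
    C *m B = 1%:M -> (forall a, V a *m B = B *m (C *m (V a *m B))) ->
  exists W : fdmod A, mdim W = e.
Proof.
move=> CB BV; pose f a := C *m (V a *m B).
have f_lin : linear f.
  by move=> c a b; rewrite /f linearP mulmxDl mulmxDr -scalemxAl -scalemxAr.
have f1 : f 1 = 1%:M by rewrite /f act1 mul1mx.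
have fM a b : f (a * b) = f a *m f b.
  by rewrite /f actM -!mulmxA -BV.
by exists (build_fdmod f_lin f1 fM).
Qed.

Lemma exists_simple (V : fdmod A) : (0 < mdim V)%N ->
  inhabited (simple_mod A).
Proof.
have [n] := ubnP (mdim V); elim: n V => // n IH V leVn V0.
have [|nsV] := pselect (is_simple V); first by move=> sV; split; exact: SimpleMod sV.
have /existsNP[U /not_implyP[stU /not_orP[U0 UT]]] :
    ~ forall U : {vspace 'cV_(mdim V)},
    (forall a v, v \in U -> V a *m v \in U) -> U = 0%VS \/ U = fullv.
  by move=> h; apply: nsV.
have dU0 : (0 < \dim U)%N by rewrite lt0n dimv_eq0; apply/eqP.
have dUV : (\dim U < mdim V)%N.
  have := dimvS (subvf U); rewrite leq_eqVlt => /orP[/eqP dE|].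
    by case: UT; apply/eqP; rewrite eqEdim subvf dE /=.
  by rewrite dimvf /dim /= muln1.
pose b := vbasis U.
pose B : 'M[k]_(mdim V, \dim U) := \matrix_(i, j) (tnth b j) i ord0.
have colB j : col j B = tnth b j by apply/colP => i; rewrite !mxE.
have BE (u : 'cV_(\dim U)) : B *m u = \sum_j u j ord0 *: tnth b j.
  apply/colP => i; rewrite mxE summxE; apply: eq_bigr => j _.
  by rewrite -colB !mxE mulrC.
have imB v : v \in U <-> exists u : 'cV_(\dim U), v = B *m u.
  split=> [vU|[u ->]].
    exists (\col_j coord b j v); rewrite {1}(coord_vbasis vU).
    by rewrite BE; apply: eq_bigr => j _; rewrite mxE (tnth_nth 0).
  rewrite BE; apply: memv_suml => j _; rewrite memvZ //.
  by rewrite vbasis_mem // mem_tnth.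
have injB (u : 'cV_(\dim U)) : B *m u = 0 -> u = 0.
  rewrite BE => h; apply/colP => j; rewrite mxE.
  have /freeP/(_ (fun j => u j ord0)) fr := basis_free (vbasisP U).
  apply: fr.
  by rewrite -[RHS]h; apply: eq_bigr => i _; rewrite (tnth_nth 0).
pose C := (pinvmx B^T)^T.
have CB : C *m B = 1%:M.
  apply: trmx_inj; rewrite trmx_mul trmxK trmx1 mulmxVp //.
  apply: inj_row_free => u uB; apply/trmx_inj; rewrite trmx0.
  by apply: injB; apply: trmx_inj; rewrite trmx_mul trmxK uB trmx0.
have BC v : v \in U -> B *m (C *m v) = v.
  by case/imB => u ->; rewrite [C *m _]mulmxA CB mul1mx.
have [a|W dW] := fdmod_restrict CB.
  apply: mx_eq_act => u; rewrite -!mulmxA BC // stU //.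
  by apply/imB; exists u.
by apply: (IH W); rewrite dW // (leq_trans dUV).
Qed.

End ExistsSimple.

Section IrrNumber.

Import VectorInternalTheory.

Variables (k : fieldType) (gT : finGroupType) (p : deco k gT).
Local Notation A := (tga p).

(** A simple module is found by descent from the regular module, written in coordinates. The
    transposes turn the row vectors of [v2r] and [lin1_mx] into the columns on which an [fdmod]
    acts. *)
Lemma inhabited_Irr : inhabited (Irr A).
Proof.
pose n := dim A.
pose f (a : A) : 'M_n := (lin1_mx (fun r : 'rV_n => v2r (a * @r2v k A r)))^T.
have fE a x : f a *m (v2r x)^T = (v2r (a * x))^T.
  rewrite -trmx_mul; congr (_^T).
  have lin : linear (fun r : 'rV_n => v2r (a * @r2v k A r)).
    by move=> c r s; rewrite linearP mulrDr -scalerAr linearP.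
  pose L := HB.pack_for {linear 'rV[k]_n -> 'rV[k]_n}
    (fun r : 'rV_n => v2r (a * @r2v k A r))
    (GRing.isLinear.Build _ _ _ _ _ lin).
  by rewrite (mul_rV_lin1 L (v2r x)) /= v2rK.
have vE (v : 'cV_n) : v = (v2r (@r2v k A v^T))^T by rewrite r2vK trmxK.
have f_lin : linear f.
  move=> c a b; apply: mx_eq_act => v; rewrite [v]vE mulmxDl -scalemxAl !fE.
  by rewrite mulrDl -scalerAl !linearP.
have f1 : f 1 = 1%:M.
  by apply: mx_eq_act => v; rewrite [v]vE fE mul1r mul1mx.
have fM a b : f (a * b) = f a *m f b.
  by apply: mx_eq_act => v; rewrite [v]vE -mulmxA !fE mulrA.
have [|W] := @exists_simple k A (build_fdmod f_lin f1 fM).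
  rewrite /= /n -dimvf lt0n dimv_eq0; apply/negP => /eqP h.
  by have := memvf (1 : A); rewrite h memv0 oner_eq0.
by split; exact: (\pi_(Irr A) W)%qT.
Qed.

(** [fset_set] is empty on infinite sets; the count is genuine thanks to [finite_Irr]. *)
Definition nIrr := #|` fset_set [set: Irr A]|%fset.

Lemma nIrr_gt0 : (0 < nIrr)%N.
Proof.
have [X] := inhabited_Irr; rewrite cardfs_gt0; apply/fset0Pn; exists X.
by rewrite in_fset_set ?mem_setT //; apply: finite_Irr.
Qed.

End IrrNumber.

(** * Comparison of the numbers of simple modules along surjective algebra morphisms *)

Section Transport.

Variables (k : fieldType) (gT hT : finGroupType).
Variables (p : deco k gT) (q : deco k hT) (phi : tga p -> tga q).
Hypotheses (phi_lin : linear phi) (phi1 : phi 1 = 1).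
Hypothesis phiM : {morph phi : x y / x * y}.
Hypothesis phi_surj : forall y, exists x, phi x = y.

Section Pullback.

Variable V : simple_mod (tga q).

Let f a := V (phi a).

Let f_lin : linear f. Proof. by move=> c a b; rewrite /f phi_lin linearP. Qed.
Let f1 : f 1 = 1%:M. Proof. by rewrite /f phi1 act1. Qed.
Let fM a b : f (a * b) = f a *m f b. Proof. by rewrite /f phiM actM. Qed.

Let pullback_simple : is_simple (build_fdmod f_lin f1 fM).
Proof.
case: (smodP V) => dV sV; split=> // U stU; apply: sV => b v vU.
by have [a <-] := phi_surj b; apply: stU.
Qed.

Definition pullback := SimpleMod pullback_simple.

End Pullback.

(** Pulling back along a surjection preserves the lattice of submodules and reflects isomorphism, so
    it is injective on isomorphism classes of simple modules. *)
Lemma nIrr_le : (nIrr q <= nIrr p)%N.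
Proof.
pose F (X : Irr (tga q)) := (\pi_(Irr (tga p)) (pullback (irr_rep X)))%qT.
have Finj : injective F.
  move=> X Y /eqP; rewrite /F eqmodE => /asboolP[P [Q [PQ QP PE]]].
  rewrite -[X]reprK -[Y]reprK; apply/eqP; rewrite eqmodE; apply/asboolP.
  by exists P, Q; split=> // b; have [a <-] := phi_surj b; apply: PE.
pose S := fset_set [set: Irr (tga q)].
suff : ([fset F X | X in S] `<=` fset_set [set: Irr (tga p)])%fset.
  by move/fsubset_leq_card; rewrite card_imfset.
apply/fsubsetP => X _; rewrite in_fset_set ?mem_setT //; exact: finite_Irr.
Qed.

End Transport.

(** The algebra is [k] itself, so every line is a submodule and a simple module has dimension 1. *)
Lemma nIrr_unit (k : fieldType) (p : deco k unit) : nIrr p = 1%N.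
Proof.
have scal (a : tga p) : a = (a 1%g : k) *: (1 : tga p).
  apply/ffunP => f; rewrite !ffunE.
  have -> : f = 1%g by apply: val_inj; case: (val f).
  by rewrite eqxx /GRing.scale /= mulr1.
have act (V : simple_mod (tga p)) a : V a = (a 1%g)%:M.
  by rewrite [in LHS](scal a) linearZ /= act1 scalemx1.
have dim1 (V : simple_mod (tga p)) : mdim V = 1%N.
  case: (smodP V) => dV sV.
  pose v : 'cV[k]_(mdim V) := delta_mx (Ordinal dV) ord0.
  have v0 : v != 0.
    apply/eqP => /matrixP/(_ (Ordinal dV) ord0)/eqP.
    by rewrite !mxE !eqxx oner_eq0.
  case: (sV <[v]>%VS) => [a w /vlineP[c ->]|h|h].
  - by rewrite act mul_scalar_mx !memvZ ?memv_line.
  - by case/eqP: v0; apply/eqP; rewrite -memv0 -h memv_line.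
  - by move: (dim_vline v); rewrite h v0 dimvf /dim /= muln1.
have [X] := inhabited_Irr p.
suff -> : nIrr p = #|` [fset X]%fset| by rewrite cardfs1.
congr (#|` _|); apply/fsetP => Y; rewrite in_fset1 in_fset_set; last first.
  exact: finite_Irr.
rewrite mem_setT; apply/esym/eqP.
rewrite -[X]reprK -[Y]reprK; apply/eqP; rewrite eqmodE; apply/asboolP.
have e : mdim (irr_rep Y) = mdim (irr_rep X) by rewrite !dim1.
rewrite -/(irr_rep X) -/(irr_rep Y).
exists (castmx (e, erefl) 1%:M), (castmx (erefl, e) 1%:M); split=> [||a].
- by case: _ / e; rewrite !castmx_id mulmx1.
- by case: _ / e; rewrite !castmx_id mulmx1.
by rewrite !act mul_scalar_mx mul_mx_scalar.
Qed.

(** * Cohomologous decorations *)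

(** The refinement of [deco_rel] without conjugation: same subgroup, same class in H^2. *)
Definition coh (k : fieldType) (gT : finGroupType) (p q : deco k gT) :=
  dgrp p = dgrp q /\ cohomologous q (dcoc p) (dcoc q).

Section Coh.

Variables (k : fieldType) (gT : finGroupType).
Implicit Types p q r : deco k gT.

Lemma cohomologous1 (L : {group gT}) (mu nu : gT -> gT -> k) (b : gT -> k) :
    mu 1%g 1%g = 1 -> nu 1%g 1%g = 1 -> {in L, forall x, b x != 0} ->
    {in L &, forall x y, nu x y = mu x y * (b x * b y / b (x * y)%g)} ->
  b 1%g = 1.
Proof.
move=> mu1 nu1 b0 /(_ 1%g 1%g (group1 L) (group1 L)).
by rewrite mu1 nu1 mulg1 mul1r mulfK ?b0.
Qed.

Lemma coc11 p : dcoc p 1%g 1%g = 1.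
Proof. by case: (dcocP p) => _ _ -> //; apply: group1. Qed.

Lemma coc_neq0 p : {in p &, forall x y, dcoc p x y != 0}.
Proof. by case: (dcocP p). Qed.

Lemma cocA p : {in p & &, forall x y z,
  dcoc p x y * dcoc p (x * y)%g z = dcoc p y z * dcoc p x (y * z)%g}.
Proof. by case: (dcocP p). Qed.

Lemma coc1l p : {in p, forall x, dcoc p 1%g x = 1}.
Proof. by case: (dcocP p). Qed.

Lemma coc1r p : {in p, forall x, dcoc p x 1%g = 1}.
Proof. by case: (dcocP p). Qed.

Lemma cohP p q (b : gT -> k) : dgrp p =i dgrp q ->
    {in q, forall x, b x != 0} ->
    {in q &, forall x y, dcoc q x y = dcoc p x y * (b x * b y / b (x * y)%g)} ->
  coh p q.
Proof. by move=> /setP/val_inj pq b0 bE; split=> //; exists b. Qed.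

Lemma eq_coh p q : dgrp p =i dgrp q ->
    {in q &, forall x y, dcoc q x y = dcoc p x y} -> coh p q.
Proof.
move=> pq E; apply: (cohP (b := fun _ => 1)) => // [x _|x y xq yq].
  exact: oner_neq0.
by rewrite E // mulr1 invr1 !mulr1.
Qed.

Lemma deco_relP p q : reflect (exists g, coh (dconj p g) q) (deco_rel p q).
Proof. exact: asboolP. Qed.

Lemma coh_deco_rel p q : coh p q -> deco_rel p q.
Proof.
move=> [pq [b b0 bE]]; apply/deco_relP; exists 1%g.
apply: (cohP (b := b)) => [x||x y xq yq] //=.
  by rewrite invg1 conjsg1 pq.
by rewrite !conjg1 bE.
Qed.

Lemma coh_trans p q r : coh p q -> coh q r -> coh p r.
Proof.
move=> [pq [b b0 bE]] [qr [c c0 cE]].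
apply: (cohP (b := fun x => b x * c x)) => [x|x xr|x y xr yr].
- by rewrite pq qr.
- by rewrite mulf_neq0 ?b0 ?c0 ?qr.
rewrite cE // bE ?qr // -!mulrA; congr (_ * _).
have bxy0 : b (x * y)%g != 0 by rewrite b0 // qr groupM.
by field; rewrite bxy0 c0 ?groupM.
Qed.

Lemma coh_sym p q : coh p q -> coh q p.
Proof.
move=> [pq [b b0 bE]].
apply: (cohP (b := fun x => (b x)^-1)) => [x|x xr|x y xr yr].
- by rewrite pq.
- by rewrite invr_neq0 // b0 -?pq.
rewrite pq in xr yr; rewrite bE //.
by field; rewrite !b0 ?groupM // oner_neq0.
Qed.

Lemma mem_dconj p g x : (x \in dconj p g) = (x ^ g \in p)%g.
Proof. by rewrite /= mem_conjgV. Qed.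

Lemma dconj_coh p q g : coh p q -> coh (dconj p g) (dconj q g).
Proof.
move=> [pq [b b0 bE]].
apply: (cohP (b := fun x => b (x ^ g)%g)) => [x|x|x y] /=.
- by rewrite pq.
- by rewrite mem_conjgV; apply: b0.
by rewrite !mem_conjgV conjMg => xq yq; rewrite bE.
Qed.

Lemma dconjM p g h : coh (dconj p (g * h)%g) (dconj (dconj p h) g).
Proof.
apply: eq_coh => [x|x y _ _]; last by rewrite /= !conjgM.
by rewrite !mem_dconj conjgM.
Qed.

(* In the twisted group algebra, u_x is a multiple of u_h u_(x ^ h) u_h^-1;
   these multiples form the required cochain. *)
Lemma dconj_inner p h : h \in p -> coh (dconj p h) p.
Proof.
move=> hp.
apply: (cohP (b := fun x => dcoc p x h / dcoc p h (x ^ h)%g)) =>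
  [x|x xp|x y xp yp].
- by rewrite mem_dconj groupJr.
- by rewrite mulf_neq0 ?invr_neq0 ?coc_neq0 ?groupJ.
rewrite /= !conjMg; set x' := (x ^ h)%g; set y' := (y ^ h)%g.
have x'p : x' \in p by rewrite groupJ.
have y'p : y' \in p by rewrite groupJ.
have hx : (h * x' = x * h)%g by rewrite -conjgC.
have hy : (h * y' = y * h)%g by rewrite -conjgC.
have E1 := cocA hp x'p y'p; have E2 := cocA xp hp y'p.
have E3 := cocA xp yp hp.
rewrite hx in E1; rewrite hy in E2; clearbody x' y'.
have N1 : dcoc p h x' != 0 by rewrite coc_neq0.
have N4 : dcoc p h (x' * y')%g != 0 by rewrite coc_neq0 ?groupM.
have N6 : dcoc p h y' != 0 by rewrite coc_neq0.
have N9 : dcoc p (x * y)%g h != 0 by rewrite coc_neq0 ?groupM.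
move: E1 E2 E3 N1 N4 N6 N9.
set A1 := dcoc p h x'; set A2 := dcoc p (x * h)%g y'; set A3 := dcoc p x' y'.
set A4 := dcoc p h (x' * y')%g; set A5 := dcoc p x h; set A6 := dcoc p h y'.
set A7 := dcoc p x (y * h)%g; set A8 := dcoc p x y.
set A9 := dcoc p (x * y)%g h; set A10 := dcoc p y h.
move=> E1 E2 E3 N1 N4 N6 N9.
(* The required identity with denominators cleared; it combines the cocycle identities at
   [(h, x', y')], [(x, h, y')] and [(x, y, h)]. *)
have E : A8 * (A9 * A1 * A6) = A3 * A5 * A10 * A4.
  transitivity ((A8 * A9) * (A1 * A6)); first by ring.
  rewrite E3; transitivity (A10 * A1 * (A6 * A7)); first by ring.
  rewrite -E2; transitivity (A10 * A5 * (A1 * A2)); first by ring.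
  by rewrite E1; ring.
apply: (mulIf (_ : A9 * A1 * A6 != 0)); first by rewrite !mulf_neq0.
by rewrite E; field; rewrite N1 N4 N6 N9.
Qed.

End Coh.

Section TwistedTransport.

Variables (k : fieldType) (gT : finGroupType).

(** Conjugation by [g] followed by rescaling by [b] is a surjective morphism of twisted group
    algebras; it preserves 1 because [b 1 = 1]. Symmetry of [deco_rel] then upgrades the inequality
    to an equality. *)
Lemma nIrr_deco_rel_le (p q : deco k gT) : deco_rel p q -> (nIrr q <= nIrr p)%N.
Proof.
move=> /deco_relP[g [/(congr1 val)/= pq [b b0 bE]]].
have b1 : b 1%g = 1.
  exact: (cohomologous1 (coc11 (dconj p g)) (coc11 q) b0 bE).
have inp (f : subg_of q) : (val f ^ g \in p)%g.
  by rewrite -mem_conjgV pq subgP.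
have inq (f : subg_of p) : (val f ^ g^-1 \in q)%g.
  by rewrite -pq memJ_conjg subgP.
pose c (f : subg_of q) := subg p (val f ^ g)%g.
pose c' (f : subg_of p) := subg q (val f ^ g^-1)%g.
have vc f : val (c f) = (val f ^ g)%g by rewrite /= subgK.
have vc' f : val (c' f) = (val f ^ g^-1)%g by rewrite /= subgK.
have cK : cancel c c' by move=> f; apply: val_inj; rewrite vc' vc conjgK.
have c'K : cancel c' c by move=> f; apply: val_inj; rewrite vc vc' conjgKV.
have cM f h : c (f * h)%g = (c f * c h)%g.
  by apply: val_inj; rewrite vc /= !subgK // conjMg.
have cV f : c f^-1%g = (c f)^-1%g.
  by apply: val_inj; rewrite vc /= !subgK // conjVg.
pose phi (x : tga p) : tga q := [ffun f => x (c f) / b (val f)].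
have phi_lin : linear phi.
  move=> a x y; apply/ffunP => f; rewrite !ffunE /GRing.scale /=.
  by rewrite mulrDl mulrA.
apply: (nIrr_le phi_lin).
- apply/ffunP => f; rewrite !ffunE -(inj_eq (can_inj cK)).
  have -> : c 1%g = 1%g by apply: val_inj; rewrite vc conj1g.
  rewrite [c f == _]eq_sym; have [E|] := eqVneq 1%g (c f); last by rewrite mul0r.
  by rewrite -[f]cK -E; rewrite vc' conj1g b1 divr1.
- move=> x y; apply/ffunP => f; rewrite !ffunE big_distrl /=.
  rewrite (reindex c) /=; last by exists c' => h _; [apply: cK|apply: c'K].
  apply: eq_bigr => h _; rewrite !ffunE -cV -cM !vc /=.
  have := bE (val h) (val (h^-1 * f)%g) (subgP _) (subgP _).
  rewrite /= mulKVg conjMg conjVg => ->; field.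
  have /= h1 := b0 _ (subgP (h^-1 * f)%g).
  by rewrite h1 !b0 ?subgP.
move=> y; exists [ffun f => y (c' f) * b (val (c' f))].
apply/ffunP => f; rewrite !ffunE cK mulfK // b0 ?subgP //.
Qed.

Lemma nIrr_deco_rel (p q : deco k gT) : deco_rel p q -> nIrr p = nIrr q.
Proof.
move=> pq; apply/eqP; rewrite eqn_leq !nIrr_deco_rel_le //.
by rewrite deco_rel_sym.
Qed.

End TwistedTransport.

(** * Clifford theory *)

Section TgaElements.

Variables (k : fieldType) (gT : finGroupType) (p : deco k gT).

Definition tga_unit (g : gT) : tga p := tga_basis (subg p g).

Lemma tga_unitM g h : g \in p -> h \in p ->
  tga_unit g * tga_unit h = dcoc p g h *: tga_unit (g * h)%g.
Proof. by move=> gp hp; rewrite /tga_unit tga_basisM morphM //= !subgK. Qed.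

Lemma tga_sum (x : tga p) : x = \sum_(f : subg_of p) x f *: tga_unit (val f).
Proof.
apply/ffunP => h; rewrite sum_ffunE (bigD1 h) //= big1 => [|f fh].
  by rewrite !ffunE sgvalK eqxx addr0 /GRing.scale /= mulr1.
by rewrite !ffunE sgvalK eq_sym (negPf fh) scaler0.
Qed.

End TgaElements.

Section CliffordTheory.

Variables (k : closedFieldType) (gT nT hT : finGroupType).
Variables (p : deco k gT) (q : gT -> nT) (r : deco k hT) (j : hT -> gT).
Hypothesis qM : {in p &, {morph q : x y / (x * y)%g}}.
Hypothesis jM : {in r &, {morph j : x y / (x * y)%g}}.
Hypothesis jp : {in r, forall b, j b \in p}.
Hypothesis j_inj : {in r &, injective j}.
Hypothesis qj : {in r, forall b, q (j b) = 1%g}.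
Hypothesis qker : forall f, f \in p -> q f = 1%g -> exists2 b, b \in r & f = j b.
Hypothesis jcoc : {in r &, forall b b', dcoc r b b' = dcoc p (j b) (j b')}.

Local Notation At := (tga p).
Local Notation A := (tga r).
Local Notation iota := (@deg1_incl k gT hT p r j).
Local Notation u := (tga_unit p).
Local Notation tensor n V W c := (@tensor_iso k gT nT hT p q r j n V W c).
Local Notation act := (@irr_act k gT nT hT p q r j).
Local Notation stab := (@irr_stab k gT nT hT p q r j).
Local Notation obstr := (@obstruction k gT nT hT p q r j).

Let q1 : q 1%g = 1%g.
Proof. by apply: (mulgI (q 1%g)); rewrite -qM ?group1 // !mulg1. Qed.

Lemma iota_linear : linear iota.
Proof.
move=> c a b; rewrite /deg1_incl scaler_sumr -big_split /=.
by apply: eq_bigr => f _; rewrite !ffunE scalerDl scalerA.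
Qed.

HB.instance Definition _ := GRing.isLinear.Build k A At *:%R iota iota_linear.

Lemma iotaZ c a : iota (c *: a) = c *: iota a.
Proof. exact: linearZ. Qed.

Lemma iota_unit b : b \in r -> iota (tga_unit r b) = u (j b).
Proof.
move=> br; rewrite /deg1_incl (bigD1 (subg r b)) //= big1 => [|b' b'b].
  by rewrite !ffunE eqxx scale1r subgK // addr0.
by rewrite ffunE (negPf b'b) scale0r.
Qed.

Lemma iotaM a b : iota (a * b) = iota a * iota b.
Proof.
rewrite (tga_sum a) (tga_sum b) mulr_suml !linear_sum mulr_suml.
apply: eq_bigr => f _; rewrite mulr_sumr !linear_sum mulr_sumr.
apply: eq_bigr => g _; rewrite -scalerAl -scalerAr /= !iotaZ.
rewrite -scalerAl -scalerAr tga_unitM ?subgP // iotaZ.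
rewrite !iota_unit ?groupM ?subgP // tga_unitM ?jp ?subgP //.
by rewrite jcoc ?subgP // jM ?subgP.
Qed.

Lemma homogeneous_unit n f : f \in p -> q f = n -> homogeneous q n (u f).
Proof.
move=> fp <- h; rewrite ffunE; case: (h =P _) => [->|]; last by rewrite eqxx.
by rewrite /= subgK.
Qed.

Lemma homogeneousM n m x y : homogeneous q n x -> homogeneous q m y ->
  homogeneous q (n * m)%g (x * y : At).
Proof.
move=> hx hy f; rewrite ffunE => xy0; pose f' : subg_of p := f.
have [a ha] : exists a : subg_of p,
    dcoc p (val a) (val (a^-1 * f')%g) * x a * y (a^-1 * f')%g != 0.
  apply: contrapT => /forallNP h; case/eqP: xy0; apply: big1 => a _.
  by have /negP := h a; rewrite negbK => /eqP.
have xa : x a != 0 by apply: contraNneq ha => ->; rewrite mulr0 mul0r.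
have ya : y (a^-1 * f')%g != 0 by apply: contraNneq ha => ->; rewrite mulr0.
by rewrite -(hx _ xa) -(hy _ ya) -qM ?subgP //= mulKVg.
Qed.

Lemma homogeneous_iota a : homogeneous q 1%g (iota a).
Proof.
move=> f; rewrite sum_ffunE => s0.
have [b hb] : exists b, (a b *: (tga_basis (subg p (j (val b)))) : At) f != 0.
  apply: contrapT => /forallNP h; case/eqP: s0; apply: big1 => b _.
  by have /negP := h b; rewrite negbK => /eqP.
move: hb; rewrite !ffunE; case: (f =P _) => [-> _|_]; last first.
  by rewrite scaler0 eqxx.
by rewrite /= subgK ?jp ?qj ?subgP.
Qed.

(** The degree [q f] part of [At] is free of rank one over [A] with basis [u f]; this is the
    coordinate, that is, the [a] with [x = iota a * u f]. *)
Definition fiber_coord (f : gT) (x : At) : A :=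
  [ffun b => x (subg p (j (val b) * f)) / dcoc p (j (val b)) f].

Lemma fiber_coord_linear f : linear (fiber_coord f).
Proof.
move=> c x y; apply/ffunP => b; rewrite !ffunE /GRing.scale /=.
by rewrite mulrDl mulrA.
Qed.

HB.instance Definition _ f :=
  GRing.isLinear.Build k At A *:%R (fiber_coord f) (fiber_coord_linear f).

Lemma iota_mul_unit f a : f \in p -> iota a * u f =
  \sum_(b : subg_of r) (a b * dcoc p (j (val b)) f) *: u (j (val b) * f)%g.
Proof.
move=> fp; rewrite mulr_suml; apply: eq_bigr => b _.
by rewrite -scalerAl tga_unitM ?jp ?subgP // scalerA.
Qed.

Lemma iota_mul_unitE f a (b : subg_of r) : f \in p ->
  (iota a * u f) (subg p (j (val b) * f)) = a b * dcoc p (j (val b)) f.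
Proof.
move=> fp; rewrite iota_mul_unit // sum_ffunE (bigD1 b) //= big1 => [|c cb].
  by rewrite !ffunE eqxx addr0 /GRing.scale /= mulr1.
rewrite !ffunE; case: eqP => [E|]; last by rewrite scaler0.
have := congr1 val E; rewrite /= !subgK ?groupM ?jp ?subgP //.
by move=> /mulIg/j_inj h; case/eqP: cb; apply: val_inj; rewrite /= h ?subgP.
Qed.

Lemma fiber_coordK f n x : f \in p -> q f = n -> homogeneous q n x ->
  iota (fiber_coord f x) * u f = x.
Proof.
move=> fp qf hx; apply/ffunP => g.
have [qg|qg] := eqVneq (q (val g)) n.
  have gfp : (val g * f^-1)%g \in p by rewrite groupM ?groupV ?subgP.
  have qfV : q f^-1%g = (q f)^-1%g.
    by apply/eqP; rewrite eq_sym eq_invg_mul -qM ?groupV // mulgV q1.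
  have [|b br gE] := qker gfp; first by rewrite qM ?groupV ?subgP // qg qfV qf mulgV.
  have -> : g = subg p (j (val (subg r b)) * f).
    by apply: val_inj; rewrite /= !subgK ?groupM ?jp // -gE mulgKV.
  rewrite iota_mul_unitE // ffunE mulfVK //.
  by rewrite coc_neq0 ?jp ?subgP.
have -> : x g = 0 by apply/eqP; apply: contraNT qg => /hx->.
rewrite iota_mul_unit // sum_ffunE big1 // => b _.
rewrite !ffunE; case: eqP => [gE|]; last by rewrite scaler0.
case/eqP: qg; rewrite gE /= subgK ?groupM ?jp ?subgP //.
by rewrite qM ?jp ?subgP // qj ?subgP // mul1g.
Qed.

Lemma fiber_coord_mul f a : f \in p -> fiber_coord f (iota a * u f) = a.
Proof.
move=> fp; apply/ffunP => b; rewrite ffunE iota_mul_unitE // mulfK //.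
by rewrite coc_neq0 ?jp ?subgP.
Qed.

Lemma fiber_coord_unit f : f \in p -> fiber_coord f (u f) = 1.
Proof.
move=> fp; have {1}-> : u f = iota 1 * u f; last exact: fiber_coord_mul.
have -> : (1 : A) = tga_unit r 1%g.
  apply/ffunP => b; rewrite !ffunE; congr ((_ == _)%:R).
  by apply: val_inj; rewrite /= subgK.
rewrite iota_unit // tga_unitM ?jp //.
have -> : j 1%g = 1%g by apply: (mulgI (j 1%g)); rewrite -jM ?mulg1.
by rewrite coc1l // mul1g scale1r.
Qed.

(** Equivalently [f] is in [p] and [u f] commutes with the degree-one part, basis element by basis
    element. *)
Definition centralizes_ker f := f \in p /\ forall b, b \in r ->
  (f * j b = j b * f)%g /\ dcoc p f (j b) = dcoc p (j b) f.

Lemma unit_iotaC f a : centralizes_ker f -> u f * iota a = iota a * u f.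
Proof.
move=> [fp fC]; rewrite mulr_sumr mulr_suml; apply: eq_bigr => b _.
rewrite -scalerAl -scalerAr; have [E1 E2] := fC _ (subgP b).
by rewrite !tga_unitM ?jp ?subgP //= E1 E2.
Qed.

Section TensorIso.

Variables (n : nT) (V W : fdmod A) (c : {linear At -> 'M[k]_(mdim W, mdim V)}).
Hypothesis cT : tensor_iso q j n c.

(** Since [u f] generates the degree [n] part over [A], its vanishing would make [c] vanish there;
    the zero map would then factor through both 0 and the identity of [W], against uniqueness. *)
Lemma tensor_iso_neq0 f : f \in p -> q f = n -> (0 < mdim W)%N -> c (u f) != 0.
Proof.
move=> fp qf dW; apply/eqP => cf0; case: cT => _ cA cU.
have c0 x : homogeneous q n x -> c x = 0.
  move=> hx; rewrite -(fiber_coordK fp qf hx) cA ?cf0 ?mulmx0 //.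
  exact: homogeneous_unit.
pose b0 : {linear At -> 'M[k]_(mdim W, mdim V)} := \0%R.
have [|h [_ hU]] := cU _ b0; first by move=> x a _; rewrite /= mul0mx.
have e : 0 = 1%:M :> 'M[k]_(mdim W).
  by rewrite -(hU 0) ?(hU 1%:M) // => x /c0 ->; rewrite mulmx0.
have /eqP := congr1 (fun M : 'M_(mdim W) => M (Ordinal dW) (Ordinal dW)) e.
by rewrite !mxE eqxx eq_sym oner_eq0.
Qed.

End TensorIso.

Definition fiber_act (V : fdmod A) f : At -> 'M[k]_(mdim V) :=
  fdact V \o fiber_coord f.

HB.instance Definition _ V f := GRing.Linear.on (@fiber_act V f).

(** The map [(iota a * u f) (x) v |-> a v] is balanced because [u f] commutes with [iota]. A
    balanced [b] factors through it by the matrix [b (u f)], and by no other. *)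
Lemma tensor_iso_fiber_act (V : fdmod A) f n : centralizes_ker f -> q f = n ->
  tensor_iso q j n (V := V) (W := V) (@fiber_act V f).
Proof.
move=> fC qf; have fp := fC.1.
have hu := homogeneous_unit fp qf.
split=> [x a hx|x a hx|d b bB] /=.
- rewrite -{1}(fiber_coordK fp qf hx) -mulrA unit_iotaC // mulrA -iotaM.
  by rewrite /fiber_act /= fiber_coord_mul // actM.
- rewrite -{1}(fiber_coordK fp qf hx) mulrA -iotaM.
  by rewrite /fiber_act /= fiber_coord_mul // actM.
exists (b (u f)); split=> [x hx|h hE].
  by rewrite -{1}(fiber_coordK fp qf hx) -unit_iotaC // bB.
by rewrite hE // /fiber_act /= fiber_coord_unit // act1 mulmx1.
Qed.

(** The usual argument for universal objects gives mutually inverse [h] and [h']. The map [h] is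
    [A]-linear since [h *m W a] and [W' a *m h] both factor the same balanced map [W' a *m c']. *)
Lemma tensor_iso_unique n (V : fdmod A) (W W' : simple_mod A)
    (c : {linear At -> 'M[k]_(mdim W, mdim V)})
    (c' : {linear At -> 'M[k]_(mdim W', mdim V)}) :
  tensor_iso q j n c -> tensor_iso q j n c' -> iso_mod W W'.
Proof.
move=> [cB cA cU] [cB' cA' cU'].
have hiota x a : homogeneous q n x -> homogeneous q n (iota a * x).
  by move=> hx; have := homogeneousM (@homogeneous_iota a) hx; rewrite mul1g.
have [h [hE _]] := cU _ c' cB'; have [h' [hE' _]] := cU' _ c cB.
have hh' : h' *m h = 1%:M.
  have [e [_ eU]] := cU _ c cB; rewrite -(eU (h' *m h)) ?(eU 1%:M) // => x hx.
    by rewrite mul1mx.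
  by rewrite -mulmxA -hE // hE'.
have h'h : h *m h' = 1%:M.
  have [e [_ eU]] := cU' _ c' cB'; rewrite -(eU (h *m h')) ?(eU 1%:M) // => x hx.
    by rewrite mul1mx.
  by rewrite -mulmxA -hE' // hE.
apply/asboolP; exists h, h'; split=> // a.
pose b : {linear At -> 'M[k]_(mdim W', mdim V)} := mulmx (W' a) \o c'.
have bB : balanced q j n b.
  by move=> x y hx; rewrite /= cB' // mulmxA.
have [e [_ eU]] := cU _ b bB.
rewrite -(eU (h *m W a)) ?(eU (W' a *m h)) // => x hx.
  by rewrite /= hE // mulmxA.
by rewrite /= -mulmxA -cA // -hE ?cA' //; apply: hiota.
Qed.

Lemma irr_actP n X Y : (exists c, tensor n (irr_rep X) (irr_rep Y) c) ->
  act n X = Y.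
Proof.
move=> [c cT]; rewrite /irr_act.
have : [set Y : Irr A | exists c, tensor n (irr_rep X) (irr_rep Y) c]%classic
    (xget X [set Y : Irr A | exists c, tensor n (irr_rep X) (irr_rep Y) c]%classic).
  by apply: (@xgetPex _ X); exists Y, c.
set Z := xget _ _ => -[c' cT']; rewrite -[Z]reprK -[Y]reprK.
by apply/eqP; rewrite eqmodE; apply: tensor_iso_unique cT' cT.
Qed.

Lemma irr_act_central X f : centralizes_ker f -> act (q f) X = X.
Proof.
by move=> fC; apply: irr_actP; eexists; apply: tensor_iso_fiber_act fC _.
Qed.

Lemma central_irr_stab X f : centralizes_ker f -> q f \in stab X.
Proof. by move=> fC; rewrite inE irr_act_central // eqxx andbT imset_f ?fC.1. Qed.

(** A central [u f] makes [c (u f)] an endomorphism of the simple module [V], a scalar by Schur, and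
    nonzero by [tensor_iso_neq0]. *)
Lemma tensor_iso_scalar (V : simple_mod A) (c : {linear At -> 'M[k]_(mdim V)}) n f :
    tensor n V V c -> centralizes_ker f -> q f = n ->
  exists2 s : k, s != 0 & c (u f) = s%:M.
Proof.
move=> cT fC qf; have fp := fC.1; have hu := homogeneous_unit fp qf.
case: (cT) => cB cA _; have [|s cs] := @schur_scalar _ _ V (c (u f)).
  by move=> a; rewrite -cB // -cA // unit_iotaC.
exists s => //; have := tensor_iso_neq0 cT fp qf (smodP V).1.
by rewrite cs; apply: contraNneq => ->; rewrite raddf0.
Qed.

(** [c (u f)] is a nonzero scalar, so it commutes with [c (u g)], and [u f] commutes with [u g].
    Hence both inverse values of [lambda] multiply the same nonzero matrix to the same result. This
    yields the commutator condition of [split_deco] for the terms of a composition. *)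
Lemma obstruction_symmetric X lambda f g :
    obstr X lambda -> centralizes_ker f -> g \in p ->
    q g \in stab X -> (f * g = g * f)%g ->
    dcoc p f g = dcoc p g f ->
  lambda (q f) (q g) = lambda (q g) (q f).
Proof.
move=> [c [cT cM]] fC gp qgX fg fgc; have fp := fC.1.
have qfX := central_irr_stab X fC.
have [s s0 cs] := tensor_iso_scalar (cT _ qfX) fC erefl.
have cg0 := tensor_iso_neq0 (cT _ qgX) gp erefl (smodP _).1.
have ug := homogeneous_unit gp erefl; have uf := homogeneous_unit fp erefl.
have E1 := cM _ _ _ _ qfX qgX uf ug; have E2 := cM _ _ _ _ qgX qfX ug uf.
have uC : u f * u g = u g * u f by rewrite !tga_unitM // fgc fg.
rewrite -qM // fg qM // uC cs mul_scalar_mx in E1.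
rewrite cs mul_mx_scalar E1 in E2.
have M0 : c (q g * q f)%g (u g * u f) != 0.
  apply: contraNneq cg0 => M0; move: E1; rewrite M0 scaler0 => /eqP.
  by rewrite scaler_eq0 (negPf s0).
apply/invr_inj/eqP; rewrite -subr_eq0; move/eqP: E2.
by rewrite -subr_eq0 -scalerBl scaler_eq0 (negPf M0) orbF.
Qed.

(** * Clifford theory with a multiplicative section of the grading that centralizes the kernel *)

Section CentralSection.

Variables (N : deco k nT) (s : nT -> gT).
Hypothesis Nqp : dgrp N =i q @: p.
Hypothesis sC : {in N, forall n, centralizes_ker (s n)}.
Hypothesis qs : {in N, cancel s q}.
Hypothesis sM : {in N &, {morph s : n m / (n * m)%g}}.
Hypothesis Ncoc : {in N &, forall n m, dcoc N n m = dcoc p (s n) (s m)}.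

Lemma central_section_act X n : n \in q @: p -> act n X = X.
Proof. by rewrite -Nqp => nN; rewrite -{1}(qs nN) irr_act_central //; apply: sC. Qed.

Lemma central_section_stab X : stab X = dgrp N.
Proof.
apply/setP => n; rewrite inE -Nqp; have [nN|//] := boolP (n \in N).
by rewrite central_section_act ?eqxx // -Nqp.
Qed.

(** The isomorphisms [fiber_act] along the section realize the cocycle exactly, because
    [u (s n) * u (s m)] is [dcoc N n m] times [u (s (n * m))]. *)
Lemma central_section_obstruction X : obstr X (dcoc N).
Proof.
exists (fun n => @fiber_act (irr_rep X) (s n)); split=> [n|n m x y].
  by rewrite central_section_stab => nN; apply: tensor_iso_fiber_act (sC nN) (qs nN).
rewrite central_section_stab => nN mN hx hy /=.
have [snp smp] : s n \in p /\ s m \in p by split; apply sC.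
rewrite -{2}(fiber_coordK snp (qs nN) hx) -{2}(fiber_coordK smp (qs mN) hy).
set a := fiber_coord _ x; set b := fiber_coord _ y.
rewrite -[_ * u (s n) * _]mulrA [u (s n) * _]mulrA (unit_iotaC _ (sC nN)).
rewrite -!mulrA tga_unitM // -Ncoc // -!scalerAr mulrA -iotaM -sM //.
rewrite /fiber_act /= linearZ /= fiber_coord_mul ?sM ?groupM //.
rewrite linearZ /= scalerA mulVf ?coc_neq0 // scale1r.
by rewrite actM.
Qed.

(** For any choice of isomorphisms, [c n] sends [u (s n)] to a nonzero scalar [z n]; the inverse of
    [z] is the cochain relating [dcoc N] to the resulting cocycle. *)
Lemma obstruction_coh X t :
  dgrp t = stab X :> {set nT} -> obstr X (dcoc t) -> coh N t.
Proof.
rewrite central_section_stab => tN [c [cT cM]].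
have inN n : (n \in t) = (n \in N) by rewrite tN.
(* The value 0 outside [N] is a mere default, making [z] a total function. *)
have ex n : exists z, n \in N -> z != 0 /\ c n (u (s n)) = z%:M.
  have [nN|] := boolP (n \in N); last by exists 0.
  have [|z z0 cz] := tensor_iso_scalar (cT n _) (sC nN) (qs nN).
    by rewrite central_section_stab.
  by exists z.
pose z n := xget 0 [set z | n \in N -> z != 0 /\ c n (u (s n)) = z%:M]%classic.
have zP n : n \in N -> z n != 0 /\ c n (u (s n)) = (z n)%:M.
  by move=> nN; apply: (@xgetPex _ 0 _ (ex n)).
apply: (cohP (b := fun n => (z n)^-1)) => [n|n|n m].
- by rewrite inN.
- by rewrite inN => /zP[]; rewrite invr_eq0.
rewrite !inN => nN mN.
have [snp smp] : s n \in p /\ s m \in p by split; apply sC.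
have := cM n m (u (s n)) (u (s m)).
rewrite !central_section_stab => /(_ nN mN).
move=> /(_ (homogeneous_unit snp (qs nN)) (homogeneous_unit smp (qs mN))).
have [z0 zE] := zP n nN; have [z0' zE'] := zP m mN.
have [z0'' zE''] := zP (n * m)%g (groupM nN mN).
rewrite tga_unitM // -sM // linearZ zE zE' zE'' -scalar_mxM /= !scale_scalar_mx.
(* Both sides are scalar matrices, so one diagonal entry decides; it exists because the dimension is
   positive. *)
pose i0 := Ordinal (smodP (irr_rep X)).1; move=> /matrixP/(_ i0 i0).
rewrite !mxE eqxx !mulr1n Ncoc // => E.
have t0 : dcoc t n m != 0 by rewrite coc_neq0 ?inN.
have {}E : z n * z m * dcoc t n m = dcoc p (s n) (s m) * z (n * m)%g.
  by rewrite E; field.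
apply: (mulfI (_ : z n * z m != 0)); first by rewrite mulf_neq0.
by rewrite E; field; rewrite z0 z0' z0'' oner_neq0.
Qed.

Lemma central_section_orbits : irr_orbits p q r j =
  ((fun X => [set X]) @` [set: Irr A])%classic.
Proof.
apply/seteqP; split=> [O [X ->]|O [X _ <-]]; exists X => //.
  apply/seteqP; split=> [Y ->|Y [n nN ->]]; last by rewrite central_section_act.
  by exists 1%g; rewrite ?central_section_act // -Nqp group1.
apply/seteqP; split=> [Y ->|Y [n nN ->]]; last by rewrite central_section_act.
by exists 1%g; rewrite ?central_section_act // -Nqp group1.
Qed.

Lemma central_section_orbit_deco X :
  coh N (@orbit_deco k gT nT hT p q r j [set X]%classic).
Proof.
rewrite /orbit_deco; set S := (X in xget _ X).
have : S (xget (deco1 k 1%G) S).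
  apply: (@xgetPex _ _ S); exists N, X => //; split.
    exact: central_section_stab.
  exact: central_section_obstruction.
by move=> [Y -> [stY obY]]; apply: (obstruction_coh (esym stY) obY).
Qed.

Lemma central_section_sum (U : zmodType) (F : dclass k nT -> U) :
  \sum_(O \in irr_orbits p q r j)
      F (dclass_of (@orbit_deco k gT nT hT p q r j O)) =
    F (dclass_of N) *+ nIrr r.
Proof.
rewrite central_section_orbits fsbig_image; last first.
  by move=> X Y _ _ /seteqP[/(_ X erefl)].
rewrite (eq_fsbigr (fun _ => F (dclass_of N))) => [|X _]; last first.
  congr F; apply/eqP; rewrite eq_sym eqmodE.
  exact/coh_deco_rel/central_section_orbit_deco.
rewrite fsbig_finite /=; last exact: finite_Irr.
by rewrite big_const_seq count_predT iter_addr_0.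
Qed.

End CentralSection.

Lemma finite_irr_orbits : finite_set (irr_orbits p q r j).
Proof.
pose orb X := [set Y | exists2 n, n \in q @: p & Y = act n X]%classic.
have : finite_set (orb @` [set: Irr A])%classic.
  by apply: finite_image; apply: finite_Irr.
by apply: sub_finite_set => O [X ->]; exists X.
Qed.

(** The list is nonempty because a simple module exists; this is the source of the positivity used
    for minimality. *)
Lemma sum_irr_orbits (U : zmodType) (F : set (Irr A) -> U) :
  exists2 s : seq (set (Irr A)), s != [::] &
    \sum_(O \in irr_orbits p q r j) F O = \sum_(O <- s) F O.
Proof.
exists (fset_set (irr_orbits p q r j)); last first.
  by rewrite fsbig_finite //; apply: finite_irr_orbits.
have [X] := inhabited_Irr r.
apply/eqP => s0; pose O := [set Y | exists2 n, n \in q @: p & Y = act n X]%classic.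
have : O \in (fset_set (irr_orbits p q r j) : seq _).
  by rewrite in_fset_set ?mem_set //; [exists X|apply: finite_irr_orbits].
by rewrite s0.
Qed.

(** The default of [xget] is kept as a case: it is the trivial subgroup, which is split as well. *)
Lemma orbit_decoP O : let t := @orbit_deco k gT nT hT p q r j O in
  t = deco1 k 1%G \/ exists2 X, O X & stab X = dgrp t /\ obstr X (dcoc t).
Proof.
rewrite /orbit_deco; set S := (X in xget _ X) => /=.
by case: (xgetP (deco1 k 1%G) S) => [t _ St|_]; [right|left].
Qed.

End CliffordTheory.

(** * Subgroups of direct products *)

Section MeetDeco.

Variables (k : fieldType) (gT : finGroupType).
Implicit Types P Q : deco k gT.

Fact meet_proof P Q :
  is_cocycle (P :&: Q)%G (fun x y => dcoc P x y * dcoc Q x y).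
Proof.
by apply: cocycle_mul;
  [apply: cocycle_comp (dcocP P)|apply: cocycle_comp (dcocP Q)] => // x /setIP[].
Qed.

(** For [P] and [Q] the inner restrictions of two factors, this is the pair (K_g, alpha_g) up to
    [coh]; see [ker_meet]. *)
Definition meet_deco P Q := Deco (meet_proof P Q).

Lemma mem_meet P Q x : (x \in meet_deco P Q) = (x \in P) && (x \in Q).
Proof. by rewrite inE. Qed.

Lemma meet_coh P Q P' Q' : coh P P' -> coh Q Q' ->
  coh (meet_deco P Q) (meet_deco P' Q').
Proof.
move=> [PP' [b b0 bE]] [QQ' [c c0 cE]].
apply: (cohP (b := fun x => b x * c x)) => [x|x|x y].
- by rewrite !mem_meet PP' QQ'.
- by rewrite mem_meet => /andP[xP xQ]; rewrite mulf_neq0 ?b0 ?c0.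
rewrite !mem_meet => /andP[xP xQ] /andP[yP yQ] /=.
by rewrite bE // cE //; field; rewrite b0 ?c0 ?groupM.
Qed.

Lemma meet_dconj P Q g :
  coh (meet_deco (dconj P g) (dconj Q g)) (dconj (meet_deco P Q) g).
Proof. by apply: eq_coh => [x|//]; rewrite mem_dconj !mem_meet !mem_dconj. Qed.

Definition dcosets (P Q : {set gT}) := [set P :* g * Q | g : gT]%g.

Definition meet_count P Q :=
  (\sum_(D in dcosets P Q) nIrr (meet_deco P (dconj Q (repr D))))%N.

Lemma coh_refl P : coh P P.
Proof. exact: eq_coh. Qed.

Lemma nIrr_coh P Q : coh P Q -> nIrr P = nIrr Q.
Proof. by move/coh_deco_rel/nIrr_deco_rel. Qed.

Lemma nIrr_dconj P g : nIrr (dconj P g) = nIrr P.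
Proof.
by apply/esym/nIrr_deco_rel/deco_relP; exists g; apply: coh_refl.
Qed.

(** [P] and [Q] absorb conjugation by their own elements up to [coh], and conjugating the whole
    intersection by [a] leaves the count unchanged. *)
Lemma nIrr_meet_dcoset P Q g a b : a \in P -> b \in Q ->
  nIrr (meet_deco P (dconj Q (a * g * b)%g)) = nIrr (meet_deco P (dconj Q g)).
Proof.
move=> aP bQ; rewrite -(nIrr_dconj (meet_deco P (dconj Q g)) a).
apply: nIrr_coh; apply: coh_trans (meet_dconj _ _ _).
apply: meet_coh; first exact: coh_sym (dconj_inner aP).
apply: coh_trans (dconjM _ _ _) _; apply: coh_trans (dconj_coh _ (dconj_inner bQ)) _.
exact: dconjM.
Qed.

Lemma nIrr_meet_repr P Q g :
  nIrr (meet_deco P (dconj Q (repr (P :* g * Q)%g))) = nIrr (meet_deco P (dconj Q g)).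
Proof.
have gD : g \in (P :* g * Q)%g.
  by rewrite -[X in X \in _]mulg1 mem_mulg // rcoset_refl.
have /mulsgP[c b /rcosetP[a aP ->] bQ ->] := mem_repr g gD.
exact: nIrr_meet_dcoset.
Qed.

(** With [x] and [y] the conjugating elements, [D |-> x D y^-1] is a bijection between the sets of
    double cosets, and conjugation by [x] matches the summands. *)
Lemma meet_count_rel P Q P' Q' : deco_rel P P' -> deco_rel Q Q' ->
  meet_count P Q = meet_count P' Q'.
Proof.
move=> /deco_relP[x Px] /deco_relP[y Qy].
have fE g : nIrr (meet_deco P' (dconj Q' g)) =
    nIrr (meet_deco P (dconj Q (x^-1 * g * y)%g)).
  rewrite -[in RHS](nIrr_dconj _ x); apply/esym/nIrr_coh.
  apply: coh_trans (coh_sym (meet_dconj _ _ _)) _; apply: meet_coh => //.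
  apply: coh_trans (dconj_coh _ Qy); apply: coh_trans (coh_sym (dconjM _ _ _)) _.
  by rewrite !mulgA mulgV mul1g; apply: dconjM.
have P'E : dgrp P' = (P :^ x^-1)%g :> {set gT} by rewrite -Px.1.
have Q'E : dgrp Q' = (Q :^ y^-1)%g :> {set gT} by rewrite -Qy.1.
pose h (D : {set gT}) := (x *: D :* y^-1)%g.
have hE g : (h (P :* g * Q) = P' :* (x * g * y^-1) * Q')%g.
  have E : ([set x^-1] * [set x * g * y^-1] * [set y] = [set g])%g.
    by rewrite !mulg_set1 !mulgA mulVg mul1g mulgKV.
  by rewrite P'E Q'E !conjsgE !invgK /h -E !mulgA.
have hinj : injective h.
  by move=> D D' /rcoset_inj/lcoset_inj.
have SE : dcosets P' Q' = h @: dcosets P Q.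
  apply/setP => D; apply/imsetP/imsetP => [[g _ ->]|[_ /imsetP[g _ ->] ->]].
    exists (P :* (x^-1 * g * y) * Q)%g; first exact: imset_f.
    by rewrite hE !mulgA mulgV mul1g mulgK.
  by exists (x * g * y^-1)%g.
rewrite /meet_count SE (big_imset _ (in2W hinj)) /=.
apply: eq_bigr => _ /imsetP[g _ ->].
by rewrite hE !nIrr_meet_repr fE !mulgA mulVg mul1g mulgKV.
Qed.

Lemma meet_count_gt0 P Q : (0 < meet_count P Q)%N.
Proof.
rewrite /meet_count (bigD1 (P :* 1 * Q)%g) /=; last by apply/imsetP; exists 1%g.
by rewrite addn_gt0 nIrr_gt0.
Qed.

End MeetDeco.

Lemma meet_count_unit (k : fieldType) (P Q : deco k unit) : meet_count P Q = 1%N.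
Proof.
rewrite /meet_count (big_pred1 (P :* tt * Q)%g) ?nIrr_unit // => D.
by apply/imsetP/eqP => [[[] _ ->]|->]; last exists tt.
Qed.

(** * Restrictions, external products and splitness in a direct product *)

Section ProductDeco.

Variables (k : fieldType) (gT hT : finGroupType).
Implicit Types L M : deco k (gT * hT)%type.

Fact restr1_proof L : is_cocycle (k1 L) (fun x y => dcoc L (x, 1%g) (y, 1%g)).
Proof.
apply: (cocycle_comp (j := fun x => (x, 1%g))) (dcocP L) => [x y _ _|x].
  by congr (_, _); rewrite mulg1.
by rewrite !inE.
Qed.
Definition restr1 L := Deco (restr1_proof L).

Fact restr2_proof L : is_cocycle (k2 L) (fun x y => dcoc L (1%g, x) (1%g, y)).
Proof.
apply: (cocycle_comp (j := fun x => (1%g, x))) (dcocP L) => [x y _ _|x].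
  by congr (_, _); rewrite mulg1.
by rewrite !inE.
Qed.
Definition restr2 L := Deco (restr2_proof L).

Lemma mem_restr1 L x : (x \in restr1 L) = ((x, 1%g) \in L).
Proof. by rewrite !inE. Qed.

Lemma mem_restr2 L y : (y \in restr2 L) = ((1%g, y) \in L).
Proof. by rewrite !inE. Qed.

Fact join_proof (P : deco k gT) (Q : deco k hT) :
  is_cocycle (setX P Q) (fun x y => dcoc P x.1 y.1 * dcoc Q x.2 y.2).
Proof.
by apply: cocycle_mul; [apply: (cocycle_comp (M := setX_group P Q) _ _ (dcocP P))
  |apply: (cocycle_comp (M := setX_group P Q) _ _ (dcocP Q))] => // -[x y] /setXP[].
Qed.
Definition join_deco (P : deco k gT) (Q : deco k hT) :=
  @Deco k _ (setX_group P Q) _ (join_proof P Q).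

Lemma mem_join P Q x y : ((x, y) \in join_deco P Q) = (x \in P) && (y \in Q).
Proof. by rewrite inE. Qed.

(** The first clause amounts to L = k_1(L) x k_2(L), see [split_mem]; the second says that the two
    factors commute in the twisted group algebra. *)
Definition split_deco L :=
  (forall x y, (x, y) \in L -> (x, 1%g) \in L) /\
  (forall x y, (x, 1%g) \in L -> (1%g, y) \in L ->
     dcoc L (x, 1%g) (1%g, y) = dcoc L (1%g, y) (x, 1%g)).

Lemma mul_pair (x x' : gT) (y y' : hT) : ((x, y) * (x', y') = (x * x', y * y'))%g.
Proof. by []. Qed.

Lemma inv_pair (x : gT) (y : hT) : ((x, y)^-1 = (x^-1, y^-1))%g.
Proof. by []. Qed.

Lemma conj_pair (x x' : gT) (y y' : hT) : ((x, y) ^ (x', y') = (x ^ x', y ^ y'))%g.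
Proof. by []. Qed.

Lemma split_memr L x y : split_deco L -> (x, y) \in L -> (1%g, y) \in L.
Proof.
move=> [sL _] xyL; have := groupM (groupVr (sL _ _ xyL)) xyL.
by rewrite inv_pair mul_pair mulVg invg1 mul1g.
Qed.

Lemma split_mem L x y : split_deco L ->
  ((x, y) \in L) = ((x, 1%g) \in L) && ((1%g, y) \in L).
Proof.
move=> sL; apply/idP/andP => [xyL|[xL yL]].
  by split; [apply: sL.1 xyL|apply: split_memr xyL].
by have := groupM xL yL; rewrite mul_pair mulg1 mul1g.
Qed.

(** The coboundary [b x * b y / b (x * y)] is symmetric on commuting elements, so it does not affect
    the second clause. *)
Lemma split_coh L M : coh L M -> split_deco L -> split_deco M.
Proof.
move=> [LM [b b0 bE]] [sL cL]; rewrite LM in sL cL; split=> // x y xM yM.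
by rewrite !bE // cL // !mul_pair !mulg1 !mul1g [b (x, _) * _]mulrC.
Qed.

Lemma split_dconj L g : split_deco L -> split_deco (dconj L g).
Proof.
case: g => g h [sL cL].
have m x y : ((x, y) \in dconj L (g, h)) = ((x ^ g, y ^ h)%g \in L).
  by rewrite mem_dconj.
split=> x y; rewrite !m !conj1g; first exact: sL.
by move=> xL yL /=; rewrite !conj_pair !conj1g cL.
Qed.

Lemma split_rel L M : deco_rel L M -> split_deco L -> split_deco M.
Proof. by case/deco_relP => g LM sL; apply: split_coh LM (split_dconj _ sL). Qed.

Lemma split_join P Q : split_deco (join_deco P Q).
Proof.
split=> x y; rewrite !mem_join; first by case/andP => ->; rewrite group1.
move=> /andP[xP _] /andP[_ yQ] /=.
by rewrite (coc1r xP) (coc1l xP) (coc1l yQ) (coc1r yQ).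
Qed.

(* Both sides are compared in the twisted group algebra of L, where u_(x,1)
   and u_(1,y) commute and have product a multiple of u_(x,y). *)
Lemma split_coh_join L : split_deco L ->
  coh (join_deco (restr1 L) (restr2 L)) L.
Proof.
move=> sL; pose c x := dcoc L (x.1, 1%g) (1%g, x.2).
have LE x : (x \in L) = ((x.1, 1%g) \in L) && ((1%g, x.2) \in L).
  by case: x => x y; rewrite split_mem.
apply: (cohP (b := fun x => (c x)^-1)) => [[x y]|x|x y].
- by rewrite mem_join mem_restr1 mem_restr2 [RHS]LE.
- by rewrite LE => /andP[x1 x2]; rewrite invr_neq0 ?coc_neq0.
move=> xL yL; have xyL := groupM xL yL.
have c0 z : z \in L -> c z != 0 by rewrite LE => /andP[z1 z2]; rewrite coc_neq0.
have [cx cy cxy] : [/\ c x != 0, c y != 0 & c (x * y)%g != 0] by rewrite !c0.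
have uE z : z \in L ->
    tga_unit L (z.1, 1%g) * tga_unit L (1%g, z.2) = c z *: tga_unit L z.
  rewrite LE => /andP[z1 z2]; rewrite tga_unitM // mul_pair mulg1 mul1g.
  by case: z {z1 z2}.
have [x1 x2] : (x.1, 1%g) \in L /\ (1%g, x.2) \in L by apply/andP; rewrite -LE.
have [y1 y2] : (y.1, 1%g) \in L /\ (1%g, y.2) \in L by apply/andP; rewrite -LE.
have uC : tga_unit L (1%g, x.2) * tga_unit L (y.1, 1%g) =
    tga_unit L (y.1, 1%g) * tga_unit L (1%g, x.2).
  by rewrite !tga_unitM // !mul_pair !mulg1 !mul1g sL.2.
have : c x *: tga_unit L x * (c y *: tga_unit L y) =
    dcoc L (x.1, 1%g) (y.1, 1%g) * dcoc L (1%g, x.2) (1%g, y.2) * c (x * y)%g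
      *: tga_unit L (x * y)%g.
  rewrite -!uE // mulrA -[_ * _ * tga_unit L (y.1, _)]mulrA uC.
  rewrite [tga_unit L (x.1, _) * (_ * _)]mulrA tga_unitM //.
  rewrite -[_ * tga_unit L (1%g, x.2) * _]mulrA tga_unitM // !mul_pair !mulg1.
  by rewrite -!scalerAl -!scalerAr [tga_unit L _ * _](uE _ xyL) !scalerA.
rewrite -!scalerAl -!scalerAr tga_unitM // !scalerA.
move=> /ffunP/(_ (subg L (x * y)%g)).
rewrite !ffunE eqxx /GRing.scale /= !mulr1 => E.
have {}E : c x * c y * dcoc L x y =
    dcoc L (x.1, 1%g) (y.1, 1%g) * dcoc L (1%g, x.2) (1%g, y.2) * c (x * y)%g.
  by rewrite -[RHS]E; ring.
apply: (mulfI (_ : c x * c y != 0)); first by rewrite mulf_neq0.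
by rewrite /= E; field; rewrite cx cy cxy oner_neq0.
Qed.

Lemma restr1_coh L M : coh L M -> coh (restr1 L) (restr1 M).
Proof.
move=> [LM [b b0 bE]]; apply: (cohP (b := fun x => b (x, 1%g))) => [x|x|x y].
- by rewrite !mem_restr1 LM.
- by rewrite mem_restr1 => /b0.
by rewrite !mem_restr1 => xM yM /=; rewrite bE // mul_pair mulg1.
Qed.

Lemma restr2_coh L M : coh L M -> coh (restr2 L) (restr2 M).
Proof.
move=> [LM [b b0 bE]]; apply: (cohP (b := fun x => b (1%g, x))) => [x|x|x y].
- by rewrite !mem_restr2 LM.
- by rewrite mem_restr2 => /b0.
by rewrite !mem_restr2 => xM yM /=; rewrite bE // mul_pair mulg1.
Qed.

Lemma restr1_dconj L g : coh (restr1 (dconj L g)) (dconj (restr1 L) g.1).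
Proof.
case: g => g h; apply: eq_coh => [x|x y _ _].
  by rewrite mem_restr1 mem_dconj mem_dconj mem_restr1 conj_pair conj1g.
by rewrite /= !conj_pair !conj1g.
Qed.

Lemma restr2_dconj L g : coh (restr2 (dconj L g)) (dconj (restr2 L) g.2).
Proof.
case: g => g h; apply: eq_coh => [x|x y _ _].
  by rewrite mem_restr2 mem_dconj mem_dconj mem_restr2 conj_pair conj1g.
by rewrite /= !conj_pair !conj1g.
Qed.

Lemma restr1_rel L M : deco_rel L M -> deco_rel (restr1 L) (restr1 M).
Proof.
case/deco_relP => g LM; apply/deco_relP; exists g.1.
exact: coh_trans (coh_sym (restr1_dconj _ _)) (restr1_coh LM).
Qed.

Lemma restr2_rel L M : deco_rel L M -> deco_rel (restr2 L) (restr2 M).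
Proof.
case/deco_relP => g LM; apply/deco_relP; exists g.2.
exact: coh_trans (coh_sym (restr2_dconj _ _)) (restr2_coh LM).
Qed.

Lemma join_rel P Q P' Q' : deco_rel P P' -> deco_rel Q Q' ->
  deco_rel (join_deco P Q) (join_deco P' Q').
Proof.
case/deco_relP => g [PP' [b b0 bE]] /deco_relP[h [QQ' [c c0 cE]]].
apply/deco_relP; exists (g, h).
apply: (cohP (b := fun x => b x.1 * c x.2)) => [[x y]|[x y]|[x y] [x' y']].
- by rewrite mem_dconj conj_pair !mem_join -PP' -QQ' !mem_dconj.
- by rewrite mem_join => /andP[xP yQ]; rewrite mulf_neq0 ?b0 ?c0.
rewrite !mem_join => /andP[xP yQ] /andP[xP' yQ'] /=.
by rewrite bE // cE //=; field; rewrite b0 ?c0 ?groupM.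
Qed.

Lemma restr1_join P Q : coh (restr1 (join_deco P Q)) P.
Proof.
apply: eq_coh => [x|x y _ _]; first by rewrite mem_restr1 mem_join group1 andbT.
by rewrite /= coc11 mulr1.
Qed.

Lemma restr2_join P Q : coh (restr2 (join_deco P Q)) Q.
Proof.
apply: eq_coh => [x|x y _ _]; first by rewrite mem_restr2 mem_join group1.
by rewrite /= coc11 mul1r.
Qed.

End ProductDeco.

(** * The fibre product and the contribution of one double coset *)

Section FibreProduct.

Variables (k : closedFieldType) (gT hT kT : finGroupType).
Variables (L : deco k (gT * hT)%type) (M : deco k (hT * kT)%type).
Local Notation F := (fib_deco L M).
Local Notation q := (@fib_proj gT hT kT).
Local Notation K := (ker_deco L M).
Local Notation j := (@ker_emb gT hT kT).

Lemma mem_fib x y y' z :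
  (((x, y), (y', z)) \in F) = [&& (x, y) \in L, (y', z) \in M & y == y'].
Proof. by rewrite inE. Qed.

Lemma mem_ker b : (b \in K) = ((1%g, b) \in L) && ((b, 1%g) \in M).
Proof. by rewrite !inE. Qed.

Lemma fib_projM : {in F &, {morph q : f h / (f * h)%g}}.
Proof. by []. Qed.

Lemma ker_embM : {in K &, {morph j : b c / (b * c)%g}}.
Proof. by move=> b c _ _; rewrite /ker_emb !mul_pair !mulg1. Qed.

Lemma ker_emb_fib : {in K, forall b, j b \in F}.
Proof. by move=> b; rewrite mem_ker mem_fib eqxx andbT. Qed.

Lemma ker_emb_inj : {in K &, injective j}.
Proof. by move=> b c _ _ []. Qed.

Lemma fib_proj_ker : {in K, forall b, q (j b) = 1%g}.
Proof. by []. Qed.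

Lemma fib_proj1 f : f \in F -> q f = 1%g -> exists2 b, b \in K & f = j b.
Proof.
case: f => -[x y] [y' z]; rewrite mem_fib => /and3P[xy yz /eqP yE] [x1 z1].
by exists y; rewrite ?mem_ker; move: xy yz; rewrite -yE x1 z1 // => -> ->.
Qed.

Lemma ker_deco_coc : {in K &, forall b c, dcoc K b c = dcoc F (j b) (j c)}.
Proof. by []. Qed.

Lemma ker_meet : coh K (meet_deco (restr2 L) (restr1 M)).
Proof. by apply: eq_coh => // b; rewrite mem_ker mem_meet mem_restr2 mem_restr1. Qed.

Lemma centralizes_kerl x : split_deco L -> (x, 1%g) \in L ->
  @centralizes_ker k _ _ F K j ((x, 1%g), 1%g).
Proof.
move=> sL xL; split=> [|b]; first by rewrite inE /= xL group1 eqxx.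
rewrite mem_ker => /andP[bL bM]; rewrite /= /fib_coc /ker_emb /= sL.2 //.
by rewrite (coc1l bM) (coc1r bM) !mul_pair !mulg1 !mul1g.
Qed.

Lemma centralizes_kerr z : split_deco M -> (1%g, z) \in M ->
  @centralizes_ker k _ _ F K j (1%g, (1%g, z)).
Proof.
move=> sM zM; split=> [|b]; first by rewrite inE /= zM group1 eqxx.
rewrite mem_ker => /andP[bL bM]; rewrite /= /fib_coc /ker_emb /= sM.2 //.
by rewrite (coc1l bL) (coc1r bL) !mul_pair !mulg1 !mul1g.
Qed.

(** The section [(x, z) |-> ((x, 1), (1, z))] is multiplicative and, both factors being split,
    centralizes the kernel, so [central_section_sum] applies. *)
Lemma ccomp_term_split : split_deco L -> split_deco M ->
  ccomp_term L M =
    B2base (dclass_of (join_deco (restr1 L) (restr2 M))) *+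
      nIrr (meet_deco (restr2 L) (restr1 M)).
Proof.
move=> sL sM; rewrite -(nIrr_coh ker_meet) /ccomp_term.
pose s (n : gT * kT) : (gT * hT) * (hT * kT) := ((n.1, 1%g), (1%g, n.2)).
set N := join_deco _ _.
have NE n : (n \in N) = ((n.1, 1%g) \in L) && ((1%g, n.2) \in M).
  by case: n => x z; rewrite mem_join mem_restr1 mem_restr2.
apply: (central_section_sum fib_projM ker_embM ker_emb_fib ker_emb_inj
  fib_proj_ker fib_proj1 ker_deco_coc (N := N) (s := s))
  => [n|n|[x z] //|n m _ _|//].
- rewrite NE; apply/andP/imsetP => [[nL nM]|[[[x y] [y' z]]]].
    by exists (s n); [rewrite mem_fib nL nM eqxx|case: n {nL nM}].
  rewrite mem_fib => /and3P[xy yz _] ->.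
  by split; [apply: sL.1 xy|apply: split_memr yz].
- rewrite NE => /andP[nL nM].
  have [f1 C1] := centralizes_kerl sL nL; have [f2 C2] := centralizes_kerr sM nM.
  split=> [|b bK]; first by rewrite mem_fib nL nM eqxx.
  move: (bK); rewrite mem_ker => /andP[bL bM].
  by rewrite /= /fib_coc /= sL.2 // sM.2 // /s /ker_emb !mul_pair !mulg1 !mul1g.
- by rewrite /s !mul_pair !mulg1.
Qed.

(** A split factor supplies kernel-centralizing lifts on its outer side. These put the outer
    elements in every stabilizer, and [obstruction_symmetric] makes the cocycle symmetric against
    them. *)
Lemma orbit_deco_split O : split_deco L \/ split_deco M ->
  split_deco (@orbit_deco k _ _ _ F q K j O).
Proof.
move=> sLM; set t := orbit_deco _ _ _ _.
have := @orbit_decoP k _ _ _ F q K j O; rewrite /= -/t => -[tE|[X _ [stX obX]]].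
  rewrite tE; split=> [x y|//]; rewrite !inE => /eqP[-> _] //.
have symm := obstruction_symmetric fib_projM ker_embM ker_emb_fib ker_emb_inj
  fib_proj_ker fib_proj1 ker_deco_coc obX.
have stab := central_irr_stab fib_projM ker_embM ker_emb_fib ker_emb_inj
  fib_proj_ker fib_proj1 ker_deco_coc X.
have stt n : (n \in t) = (n \in @irr_stab k _ _ _ F q K j X) by rewrite stX.
have tF n : n \in t -> exists y, (n.1, y) \in L /\ (y, n.2) \in M.
  rewrite stt inE => /andP[/imsetP[[[x y] [y' z]]]].
  rewrite mem_fib => /and3P[xy yz /eqP yE] -> _.
  by exists y; split=> //; rewrite yE.
case: sLM => [sL|sM].
  have inL x : (x, 1%g) \in L -> (x, 1%g) \in t.
    by move=> xL; rewrite stt; have := stab _ (centralizes_kerl sL xL).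
  split=> [x y /tF[z [/sL.1/inL]]//|x y xt yt].
  have [y0 [xL _]] := tF _ xt; have {}xL := sL.1 _ _ xL.
  have [z [zL zM]] := tF _ yt.
  (* The other element needs only some lift to the fibre product, so its middle coordinate [z] may
     be nontrivial. *)
  have := symm _ ((1%g, z), (z, y)) (centralizes_kerl sL xL); apply.
  - by rewrite mem_fib zL zM eqxx.
  - by rewrite -stt.
  - by rewrite !mul_pair !mulg1 !mul1g.
  by rewrite /= /fib_coc /= sL.2 // (coc1l zM) (coc1r zM).
have inM z : (1%g, z) \in M -> (1%g, z) \in t.
  by move=> zM; rewrite stt; have := stab _ (centralizes_kerr sM zM).
split=> [x y xyt|x y xt yt].
  have [z [_ /(split_memr sM)/inM yt]] := tF _ xyt.
  have := groupM xyt (groupVr yt).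
  by rewrite inv_pair mul_pair invg1 mulg1 mulgV.
have [z [_ /(split_memr sM) yM]] := tF _ yt.
have [y0 [xL y0M]] := tF _ xt.
apply/esym; have := symm _ ((x, y0), (y0, 1%g)) (centralizes_kerr sM yM); apply.
- by rewrite mem_fib xL y0M eqxx.
- by rewrite -stt.
- by rewrite !mul_pair !mulg1 !mul1g.
by rewrite /= /fib_coc /= sM.2 // (coc1l xL) (coc1r xL).
Qed.

Lemma ccomp_term_seq : exists s : seq (bicl k gT kT), [/\ s != [::],
  ccomp_term L M = \sum_(x <- s) B2base x &
  split_deco L \/ split_deco M -> {in s, forall x, split_deco (dclass_rep x)}].
Proof.
have [s s0 sE] := @sum_irr_orbits k _ _ _ F q K j _
  (fun O => B2base (dclass_of (@orbit_deco k _ _ _ F q K j O))).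
exists [seq dclass_of (@orbit_deco k _ _ _ F q K j Y) | Y <- s]; split.
- by rewrite -size_eq0 size_map size_eq0.
- by rewrite /ccomp_term sE big_map.
move=> sLM _ /mapP[O _ ->]; apply: split_rel (orbit_deco_split O sLM).
by rewrite -(eqmodE (deco_equiv k _)) /dclass_rep /dclass_of reprK.
Qed.

End FibreProduct.

Section Classes.

Variables (k : fieldType) (gT : finGroupType).
Implicit Types p q : deco k gT.

Lemma dclass_of_eq p q : deco_rel p q <-> dclass_of p = dclass_of q.
Proof.
split=> [pq|/eqP]; first by apply/eqP; rewrite /dclass_of eqmodE.
by rewrite /dclass_of eqmodE.
Qed.

Lemma dclass_repK (x : dclass k gT) : dclass_of (dclass_rep x) = x.
Proof. exact: reprK. Qed.

Lemma dclass_ofK p : deco_rel (dclass_rep (dclass_of p)) p.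
Proof. by apply/dclass_of_eq; rewrite dclass_repK. Qed.

End Classes.

Lemma B2_sum (k : fieldType) (gT hT : finGroupType) (x : B2 k gT hT) :
  x = \sum_(z <- dom x) B2base z *~ coeff z x.
Proof.
rewrite -{1}(freeg_sumE x); apply: eq_bigr => z _.
by rewrite /B2base freegU_mulz intz.
Qed.

(** * Composition *)

Section Composition.

Variables (k : closedFieldType) (gT hT kT : finGroupType).
Implicit Types (x : bicl k gT hT) (y : bicl k hT kT).

Definition split_class (gT hT : finGroupType) (x : bicl k gT hT) :=
  split_deco (dclass_rep x).

Lemma split_class_of (L : deco k (gT * hT)%type) :
  split_class (dclass_of L) <-> split_deco L.
Proof.
split=> sL; first exact: split_rel (dclass_ofK L) sL.
by apply: split_rel sL; rewrite deco_rel_sym; apply: dclass_ofK.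
Qed.

(** For split factors p_2 and p_1 coincide with k_2 and k_1, so the double cosets are those of
    [meet_count]. The conjugation by [(repr D, 1)] is trivial on the outer side, whence the same
    basis element for every [D]. *)
Lemma ccomp_basis_split x y : split_class x -> split_class y ->
  ccomp_basis x y =
    B2base (dclass_of
        (join_deco (restr1 (dclass_rep x)) (restr2 (dclass_rep y)))) *+
      meet_count (restr2 (dclass_rep x)) (restr1 (dclass_rep y)).
Proof.
rewrite /split_class /ccomp_basis; move: (dclass_rep x) (dclass_rep y) => L M sL sM.
have E1 : p2 L = restr2 L :> {set hT}.
  apply/setP => b; rewrite mem_restr2; apply/morphimP/idP => [[[x0 b0] _ xL ->]|bL].
    exact: split_memr xL.
  by exists (1%g, b).
have E2 : p1 M = restr1 M :> {set hT}.
  apply/setP => b; rewrite mem_restr1; apply/morphimP/idP => [[[b0 y0] _ yM ->]|bM].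
    exact: sM.1 yM.
  by exists (b, 1%g).
rewrite E1 E2 /meet_count -sumrMnr; apply: eq_bigr => D _.
rewrite ccomp_term_split //; last exact: split_dconj.
congr (B2base _ *+ _).
  apply/dclass_of_eq/join_rel; first exact: deco_rel_refl.
  rewrite deco_rel_sym; apply/deco_relP; exists 1%g.
  exact: coh_sym (restr2_dconj M (repr D, 1%g)).
by apply: nIrr_coh; apply: meet_coh (coh_refl _) (restr1_dconj M (repr D, 1%g)).
Qed.

(** The lists of the double cosets are concatenated; the double coset of 1 ensures that the result
    is nonempty. *)
Lemma ccomp_basis_seq x y : exists s : seq (bicl k gT kT), [/\ s != [::],
  ccomp_basis x y = \sum_(z <- s) B2base z &
  split_class x \/ split_class y -> {in s, forall z, split_class z}].
Proof.
rewrite /split_class /ccomp_basis; move: (dclass_rep x) (dclass_rep y) => L M.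
set Ds := [set _ | g in _].
have Ds0 : enum Ds != [::].
  rewrite -size_eq0 -cardE cards_eq0; apply/set0Pn.
  by exists (p2 L :* 1 * p1 M)%g; apply/imsetP; exists 1%g.
rewrite -big_enum /=; elim: (enum Ds) Ds0 => // D s IH _.
have [s1 [s10 s1E s1P]] := ccomp_term_seq L (dconj M (repr D, 1%g)).
have s1P' : split_deco L \/ split_deco M ->
    {in s1, forall z, split_deco (dclass_rep z)}.
  by move=> sLM; apply: s1P; case: sLM => ?; [left|right; apply: split_dconj].
case: s IH => [_|D' s /(_ isT) [s2 [_ s2E s2P]]].
  by exists s1; split=> //; rewrite big_seq1.
exists (s1 ++ s2); split; first by case: s1 s10 {s1E s1P s1P'}.
  by rewrite big_cons s1E s2E big_cat.
by move=> sLM z; rewrite mem_cat => /orP[/(s1P' sLM)|/(s2P sLM)].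
Qed.

Lemma ccomp_base x y : ccomp (B2base x) (B2base y) = ccomp_basis x y.
Proof. by rewrite /ccomp /B2base !liftU !scale1r. Qed.

Fact ccompl_additive (y : B2 k hT kT) : additive (fun x : B2 k gT hT => ccomp x y).
Proof. exact: lift_is_additive. Qed.

Let ccompl (y : B2 k hT kT) : {additive B2 k gT hT -> B2 k gT kT} :=
  HB.pack_for {additive B2 k gT hT -> B2 k gT kT} (fun x : B2 k gT hT => ccomp x y)
    (GRing.isAdditive.Build (B2 k gT hT) (B2 k gT kT)
      (fun x : B2 k gT hT => ccomp x y) (ccompl_additive y)).

Lemma ccomp_suml I (s : seq I) (F : I -> B2 k gT hT) (y : B2 k hT kT) :
  ccomp (\sum_(i <- s) F i) y = \sum_(i <- s) ccomp (F i) y.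
Proof. exact: (raddf_sum (ccompl y)). Qed.

Lemma ccomp_addl (x x' : B2 k gT hT) (y : B2 k hT kT) :
  ccomp (x + x') y = ccomp x y + ccomp x' y.
Proof. exact: (raddfD (ccompl y)). Qed.

Lemma ccompMzl (x : B2 k gT hT) (y : B2 k hT kT) n :
  ccomp (x *~ n) y = ccomp x y *~ n.
Proof. exact: (raddfMz (ccompl y)). Qed.

Fact ccompr_additive (x : B2 k gT hT) : additive (fun y : B2 k hT kT => ccomp x y).
Proof.
move=> y y'; rewrite [x]B2_sum.
(* [ccomp] is a lift in its left argument, so additivity in the right one appears only after
   expanding [x] over the basis. *)
have E z : ccomp (\sum_(w <- dom x) B2base w *~ coeff w x) z =
    \sum_(w <- dom x) fglift (ccomp_basis w) z *~ coeff w x :> B2 k gT kT.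
  rewrite ccomp_suml; apply: eq_bigr => w _.
  by rewrite ccompMzl /ccomp liftU scale1r.
rewrite !E -sumrB; apply: eq_bigr => w _.
by rewrite lift_is_additive mulrzBl.
Qed.

Let ccompr (x : B2 k gT hT) : {additive B2 k hT kT -> B2 k gT kT} :=
  HB.pack_for {additive B2 k hT kT -> B2 k gT kT} (fun y : B2 k hT kT => ccomp x y)
    (GRing.isAdditive.Build (B2 k hT kT) (B2 k gT kT)
      (fun y : B2 k hT kT => ccomp x y) (ccompr_additive x)).

Lemma ccomp_sumr I (s : seq I) (F : I -> B2 k hT kT) (x : B2 k gT hT) :
  ccomp x (\sum_(i <- s) F i) = \sum_(i <- s) ccomp x (F i).
Proof. exact: (raddf_sum (ccompr x)). Qed.

Lemma ccomp_addr (x : B2 k gT hT) (y y' : B2 k hT kT) :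
  ccomp x (y + y') = ccomp x y + ccomp x y'.
Proof. exact: (raddfD (ccompr x)). Qed.

Lemma ccompMzr (x : B2 k gT hT) (y : B2 k hT kT) n :
  ccomp x (y *~ n) = ccomp x y *~ n.
Proof. exact: (raddfMz (ccompr x)). Qed.

End Composition.

Lemma ccompE (k : closedFieldType) (gT hT kT : finGroupType)
    (x : B2 k gT hT) (y : B2 k hT kT) :
  ccomp x y = \sum_(z <- dom x) \sum_(w <- dom y)
    ccomp_basis z w *~ (coeff z x * coeff w y).
Proof.
rewrite {1}[x]B2_sum ccomp_suml; apply: eq_bigr => z _.
rewrite {1}[y]B2_sum ccomp_sumr; apply: eq_bigr => w _.
by rewrite ccompMzl ccompMzr ccomp_base -mulrzA mulrC.
Qed.

(** * Spans of basis elements, described by coefficients *)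

Section Supported.

Variables (k : fieldType) (gT hT : finGroupType) (S : set (bicl k gT hT)).

Definition supported (x : B2 k gT hT) := forall z, coeff z x != 0 -> S z.

Lemma supported_sum (I : eqType) (r : seq I) (F : I -> B2 k gT hT) :
  {in r, forall i, supported (F i)} -> supported (\sum_(i <- r) F i).
Proof.
move=> SF z; rewrite raddf_sum /= big_seq => s0; apply: contrapT => nSz.
case/eqP: s0; apply: big1 => i ir; apply/eqP/negPn/negP => c0.
exact: nSz (SF i ir z c0).
Qed.

Lemma supportedB x y : supported x -> supported y -> supported (x - y).
Proof.
move=> Sx Sy z; rewrite coeffB; have [x0|/Sx//] := eqVneq (coeff z x) 0.
by rewrite x0 sub0r oppr_eq0 => /Sy.
Qed.

Lemma supported0 : supported 0.
Proof. by move=> z; rewrite coeff0 eqxx. Qed.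

Lemma supportedMz x n : supported x -> supported (x *~ n).
Proof.
move=> Sx z; rewrite raddfMz /= => zn; apply: Sx; apply: contraNneq zn => ->.
by rewrite mul0rz.
Qed.

Lemma coeff_B2base z x : coeff z (B2base x : B2 k gT hT) = (x == z)%:R.
Proof. by rewrite /B2base coeffU mul1r. Qed.

Lemma supported_base z : S z -> supported (B2base z).
Proof.
by move=> Sz w; rewrite coeff_B2base; case: (z =P w) => [<-|]; rewrite ?eqxx.
Qed.

(** Turns membership in a based ideal into a condition on each nonzero coefficient; [J_sub] extracts
    basis elements this way. *)
Lemma zspan_supported : zspan [set B2base z | z in S]%classic = supported.
Proof.
apply/seteqP; split=> [_ [s sS ->]|x Sx].
  apply: supported_sum => a /sS [w Sw <-].
  exact: supportedMz (supported_base Sw).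
exists [seq (coeff z x, B2base z) | z <- dom x].
  by move=> _ /mapP[z + ->]; rewrite mem_dom => /Sx Sz; exists z.
by rewrite big_map {1}[x]B2_sum.
Qed.

End Supported.

(** * Duality and trivial factors *)

Section Dual.

Variables (k : fieldType) (gT hT : finGroupType).
Implicit Types L M : deco k (gT * hT)%type.

Lemma mem_dual L x : (x \in dual_deco L) = (swap x \in L).
Proof. by rewrite !inE. Qed.

Lemma dual_rel L M : deco_rel L M -> deco_rel (dual_deco L) (dual_deco M).
Proof.
case/deco_relP => g [LM [b b0 bE]]; apply/deco_relP; exists (g.2, g.1).
apply: (cohP (b := fun x => (b (swap x))^-1)) => [x|x|x y].
- by rewrite mem_dconj !mem_dual -LM mem_dconj; case: g {LM b0 bE}.
- by rewrite mem_dual => xM; rewrite invr_neq0 ?b0.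
rewrite !mem_dual => xM yM; have xyM := groupM xM yM.
rewrite /= bE //=; case: g x y {LM bE} xM yM xyM => g h [x x'] [y y'] xM yM xyM.
rewrite !invfM !invrK /= [in RHS]mulrC.
by rewrite [in LHS]mulrC; congr (_ * _).
Qed.

End Dual.

Lemma dual_dual (k : fieldType) (gT hT : finGroupType) (L : deco k (gT * hT)%type) :
  coh (dual_deco (dual_deco L)) L.
Proof.
apply: eq_coh => [[x y]|[x y] [x' y'] _ _]; first by rewrite !mem_dual.
by rewrite /= invrK.
Qed.

Section UnitFactor.

Variables (k : fieldType) (gT : finGroupType).

Lemma unit_eq1 (x : unit) : x = 1%g. Proof. by case: x. Qed.

Lemma split_unitr (L : deco k (gT * unit)%type) : split_deco L.
Proof.
split=> x y; rewrite [y]unit_eq1 // => xL _.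
by rewrite (coc1r xL) (coc1l xL).
Qed.

Lemma split_unitl (L : deco k (unit * gT)%type) : split_deco L.
Proof.
split=> x y; rewrite [x]unit_eq1 ?group1 // => _ yL.
by rewrite (coc1r yL) (coc1l yL).
Qed.

Lemma dclass_unit (x : bicl k unit unit) : x = id11 k.
Proof.
rewrite -[x]dclass_repK; apply/dclass_of_eq/coh_deco_rel.
have one (z : unit * unit) : z = 1%g by case: z => [[] []].
apply: eq_coh => [z|z w _ _]; first by rewrite [z]one !group1.
by rewrite [z]one [w]one !coc11.
Qed.

End UnitFactor.

(** * The ideal of matrix units *)

Section Matrices.

Variables (k : closedFieldType) (gT : finGroupType).
Local Notation Om := (Omega k gT).
Implicit Types a b c d : Om.

Definition dual_class b : bicl k unit gT := dclass_of (dual_deco (dclass_rep b)).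

Definition E_class a b : bicl k gT gT :=
  dclass_of (join_deco (restr1 (dclass_rep a)) (restr2 (dclass_rep (dual_class b)))).

Definition pairing b c : nat :=
  meet_count (restr2 (dclass_rep (dual_class b))) (restr1 (dclass_rep c)).

Lemma pairing_gt0 b c : (0 < pairing b c)%N.
Proof. exact: meet_count_gt0. Qed.

Lemma B2dual_base b : B2dual (B2base b) = B2base (dual_class b).
Proof. by rewrite /B2dual /B2base liftU scale1r. Qed.

(** Over the trivial middle group every decoration is split and [meet_count] is 1, so the product is
    a single basis element. *)
Lemma E_base a b : E_ a b = B2base (E_class a b).
Proof.
rewrite /E_ B2dual_base ccomp_base ccomp_basis_split.
- by rewrite meet_count_unit.
- exact: split_unitr.
- exact: split_unitl.
Qed.

Lemma dual_comp b c :
  ccomp (B2dual (B2base b)) (B2base c) = B2base (id11 k) *+ pairing b c.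
Proof.
rewrite B2dual_base ccomp_base ccomp_basis_split.
- by rewrite [dclass_of _]dclass_unit.
- exact: split_unitl.
- exact: split_unitr.
Qed.

Lemma cpairE b c : cpair b c = (pairing b c)%:Z.
Proof.
rewrite /cpair dual_comp raddfMn /= coeff_B2base eqxx.
by rewrite -mulr_natr mul1r natz.
Qed.

Lemma split_E_class a b : split_class (E_class a b).
Proof. exact/split_class_of/split_join. Qed.

(** The inner restrictions of [E_ a b] and [E_ c d] are, up to [deco_rel], those of the dual of [b]
    and of [c], so the multiplicity is the one in [dual_comp]. *)
Lemma E_comp a b c d : ccomp (E_ a b) (E_ c d) = E_ a d *+ pairing b c.
Proof.
rewrite !E_base ccomp_base ccomp_basis_split; try exact: split_E_class.
have r1 a' b' : deco_rel (restr1 (dclass_rep (E_class a' b'))) (restr1 (dclass_rep a')).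
  apply: deco_rel_trans (restr1_rel (dclass_ofK _)) _.
  exact/coh_deco_rel/restr1_join.
have r2 a' b' : deco_rel (restr2 (dclass_rep (E_class a' b')))
    (restr2 (dclass_rep (dual_class b'))).
  apply: deco_rel_trans (restr2_rel (dclass_ofK _)) _.
  exact/coh_deco_rel/restr2_join.
congr (B2base _ *+ _); first exact/dclass_of_eq/join_rel.
exact: meet_count_rel.
Qed.

Lemma split_class_E (z : bicl k gT gT) : split_class z ->
  exists a b, z = E_class a b.
Proof.
move=> sz; set t := dclass_rep z in sz.
pose P := restr1 t; pose Q := restr2 t; pose U := deco1 k 1%G : deco k unit.
(* The second witness is a dual because [E_class] dualizes its second argument; the two duals cancel
   up to [coh]. *)
exists (dclass_of (join_deco P U)), (dclass_of (dual_deco (join_deco U Q))).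
rewrite -[LHS]dclass_repK -/t; apply/dclass_of_eq; rewrite deco_rel_sym.
apply: deco_rel_trans (coh_deco_rel (split_coh_join sz)); apply: join_rel.
  apply: deco_rel_trans (restr1_rel (dclass_ofK _)) _.
  exact/coh_deco_rel/restr1_join.
apply: deco_rel_trans (restr2_rel (dclass_ofK _)) _.
apply: deco_rel_trans (restr2_rel (dual_rel (dclass_ofK _))) _.
apply: deco_rel_trans (restr2_rel (coh_deco_rel (dual_dual _))) _.
exact/coh_deco_rel/restr2_join.
Qed.

Lemma J_supported : J_ k gT = supported [set z | split_class z]%classic.
Proof.
rewrite -zspan_supported /J_; congr zspan; apply/seteqP; split=> x.
  move=> [a [b ->]]; rewrite E_base; exists (E_class a b) => //.
  exact: split_E_class.
by move=> [z /split_class_E[a [b ->]] <-]; exists a, b; rewrite E_base.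
Qed.

Lemma supported_ccomp (x y : B2 k gT gT) :
  J_ k gT x \/ J_ k gT y -> J_ k gT (ccomp x y).
Proof.
rewrite J_supported => Jxy; rewrite ccompE.
apply: supported_sum => z zx; apply: supported_sum => w wy.
apply: supportedMz; have [s [_ -> sP]] := ccomp_basis_seq z w.
apply: supported_sum => v vs; apply: supported_base; apply: sP vs.
by case: Jxy => J; [left|right]; apply: J; rewrite -mem_dom.
Qed.

Lemma J_ideal : ideal (J_ k gT).
Proof.
split.
- by rewrite J_supported; apply: supported0.
- by rewrite J_supported => x y; apply: supportedB.
- by move=> r x Jx; apply: supported_ccomp; right.
- by move=> r x Jx; apply: supported_ccomp; left.
Qed.

Lemma J_based : based_ideal (J_ k gT).
Proof.
split; first exact: J_ideal.
by exists [set z | split_class z]%classic; rewrite zspan_supported J_supported.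
Qed.

Lemma E_in_J a b : J_ k gT (E_ a b).
Proof.
by rewrite E_base J_supported; apply: supported_base; apply: split_E_class.
Qed.

Lemma J_nonzero : nonzero_based_ideal (J_ k gT).
Proof.
split; first exact: J_based.
pose a : Om := dclass_of (deco1 k 1%G); exists (E_ a a); first exact: E_in_J.
rewrite E_base; apply/eqP => /(congr1 (coeff (E_class a a))).
by rewrite coeff0 coeff_B2base eqxx.
Qed.

Lemma J_sub (I : set (B2 k gT gT)) : nonzero_based_ideal I -> (J_ k gT `<=` I)%classic.
Proof.
move=> [[[I0 IB Il Ir] [S IS]] [x Ix x0]].
rewrite zspan_supported in IS.
have [z zx] : exists z, coeff z x != 0.
  apply: contrapT => /forallNP nz; case/eqP: x0; apply/eqP/freeg_eqP => z.
  by rewrite coeff0; apply/eqP/negPn/negP/nz.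
have Sz : S z by move: Ix; rewrite IS; apply.
have Iz : I (B2base z) by rewrite IS; apply: supported_base.
have IE c d : I (E_ c d).
  have [s [s0 sE sP]] := ccomp_basis_seq (E_class c c) z.
  have Iy : I (ccomp (ccomp (E_ c c) (ccomp (E_ c c) (B2base z))) (E_ d d)).
    by apply: Ir; do 2!apply: (Il).
  have ss : {in s, forall v, split_class v}.
    by apply: sP; left; apply: split_E_class.
  have yE : ccomp (E_ c c) (B2base z) = \sum_(v <- s) B2base v.
    by rewrite E_base ccomp_base sE.
  move: Iy; rewrite yE.
  (* Each term [E_ a b] of the list contributes [pairing c a * pairing b d], so [m] is a nonempty
     sum of positive integers. *)
  have [m m0 ->] : exists2 m, (0 < m)%N &
      ccomp (ccomp (E_ c c) (\sum_(v <- s) B2base v)) (E_ d d) = E_ c d *+ m.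
    elim: s s0 ss {sE sP yE} => // v s IH _ ss.
    have [a [b vE]] := split_class_E (ss v (mem_head _ _)).
    have E1 :
        ccomp (ccomp (E_ c c) (B2base v)) (E_ d d) =
        E_ c d *+ (pairing c a * pairing b d).
      by rewrite vE -E_base E_comp pmulrn ccompMzl E_comp -pmulrn -mulrnA mulnC.
    case: s IH ss => [_ _|w s IH ss].
      exists (pairing c a * pairing b d)%N; first by rewrite muln_gt0 !pairing_gt0.
      by rewrite big_seq1.
    have [//||m m0 mE] := IH.
      by move=> u us; apply: ss; rewrite inE us orbT.
    exists (pairing c a * pairing b d + m)%N; first by rewrite addn_gt0 m0 orbT.
    by rewrite big_cons !ccomp_addr ccomp_addl E1 mE mulrnDr.
  (* The coefficient [m] of [E_class c d] is nonzero, and [I] is based, so the basis element itself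
     lies in [I]. *)
  rewrite IS E_base => /(_ (E_class c d)).
  rewrite raddfMn /= coeff_B2base eqxx => h; apply: supported_base; apply: h.
  by rewrite -mulr_natr mul1r pnatr_eq0 -lt0n.
rewrite J_supported IS => y Jy v /Jy /split_class_E[a [b ->]].
have := IE a b; rewrite IS E_base => /(_ (E_class a b)); apply.
by rewrite coeff_B2base eqxx.
Qed.

End Matrices.

Theorem proposition3p3 (k : closedFieldType) (hk : [pchar k] =i pred0)
    (gT : finGroupType) :
  [/\ forall b c : Omega k gT,
        0 < cpair b c /\
        ccomp (B2dual (B2base b)) (B2base c) = B2base (id11 k) *~ cpair b c,
      based_ideal (J_ k gT),
      forall a b c d : Omega k gT,
        ccomp (E_ a b) (E_ c d) = E_ a d *~ cpair b c &
      forall I : set (B2 k gT gT),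
        minimal_based_ideal I <-> I = J_ k gT].
Proof.
split=> [b c||a b c d|I].
- by rewrite cpairE -pmulrn dual_comp ltz_nat pairing_gt0.
- exact: J_based.
- by rewrite E_comp cpairE -pmulrn.
split=> [[nzI minI]|->].
  by apply/esym/minI; [apply: J_nonzero|apply: J_sub].
split=> [|I' nzI' I'J]; first exact: J_nonzero.
by apply/seteqP; split=> //; apply: J_sub.
Qed.
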